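(* Let $F(x,y)=a_0x^4+a_1x^3y+a_2x^2y^2+a_3xy^3+a_4y^4$ be a binary quartic form with integer coefficients which is irreducible over $\mathbb{Q}$, has positive discriminant, and splits over $\mathbb{R}$ (i.e. all four roots of $F(x,1)$ are real). If $J_F=0$, then the Diophantine equation $|F(x,y)|=1$ has at most $12$ solutions in integers $x,y$, where $(x,y)$ and $(-x,-y)$ are regarded as the same solution.
   Context: The invariants of $F$ are $I_F=a_2^2-3a_1a_3+12a_0a_4$ and $J_F=2a_2^3-9a_1a_2a_3+27a_1^2a_4-72a_0a_2a_4+27a_0a_3^2$. The discriminant is $D_F=a_0^6\prod_{i<j}(\alpha_i-\alpha_j)^2$ where $\alpha_1,\dots,\alpha_4$ are the roots of $F(x,1)$; one has $27D_F=4I_F^3-J_F^2$. *)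

(* Defs.v *)
From HB Require Import structures.
From mathcomp Require Import all_boot all_order all_algebra.
From mathcomp Require Import complex reals.
From mathcomp Require Import mpoly.

Set Implicit Arguments.
Unset Strict Implicit.
Unset Printing Implicit Defensive.

Import Order.TTheory GRing.Theory Num.Theory.
Local Open Scope ring_scope.
Local Open Scope complex_scope.

(* A form with integer coefficients, evaluated in an arbitrary commutative
   ring: [quartic a0 .. a4 x y] with x y : int is the value F(x, y), with
   arguments 'X and 1 it is the polynomial F(x, 1), and with arguments 'X_0
   and 'X_1 it is the form itself. *)
Definition quartic (A : comNzRingType) (a0 a1 a2 a3 a4 : int) (x y : A) : A :=
  a0%:~R * x ^+ 4 + a1%:~R * x ^+ 3 * y + a2%:~R * x ^+ 2 * y ^+ 2
  + a3%:~R * x * y ^+ 3 + a4%:~R * y ^+ 4.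

Definition quartic_form (K : fieldType) (a0 a1 a2 a3 a4 : int) : {mpoly K[2]} :=
  quartic a0 a1 a2 a3 a4 'X_0 'X_1.

Definition dehomog (K : fieldType) (a0 a1 a2 a3 a4 : int) : {poly K} :=
  quartic a0 a1 a2 a3 a4 'X 1.

Definition irreducible_elt (A : idomainType) (p : A) : Prop :=
  [/\ p != 0, p \isn't a GRing.unit &
      forall q r : A,
        p = q * r -> q \is a GRing.unit \/ r \is a GRing.unit].

Definition irreducible_over_Q (a0 a1 a2 a3 a4 : int) : Prop :=
  irreducible_elt (quartic_form rat a0 a1 a2 a3 a4).

Definition splits_over (K : fieldType) (a0 a1 a2 a3 a4 : int) : Prop :=
  exists alpha : 'I_4 -> K,
    dehomog K a0 a1 a2 a3 a4 =
    a0%:~R *: \prod_(i < 4) ('X - (alpha i)%:P).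

(* Roots listed with multiplicity. *)
Definition complex_roots (R : realType) (a0 a1 a2 a3 a4 : int) : seq R[i] :=
  sval (closed_field_poly_normal (dehomog R[i] a0 a1 a2 a3 a4)).

(* When a0 = 0 there are fewer than four roots, but the factor a0 ^+ 6 makes
   the value 0.  The order on R[i] is such that 0 < z means that z is real
   and positive. *)
Definition disc (R : realType) (a0 a1 a2 a3 a4 : int) : R[i] :=
  let alpha := complex_roots R a0 a1 a2 a3 a4 in
  a0%:~R ^+ 6 *
  \prod_(i < 4) \prod_(j < 4 | (i < j)%N) (alpha`_i - alpha`_j) ^+ 2.

Definition invJ (a0 a1 a2 a3 a4 : int) : int :=
  2 * a2 ^+ 3 - 9 * a1 * a2 * a3 + 27 * a1 ^+ 2 * a4
  - 72 * a0 * a2 * a4 + 27 * a0 * a3 ^+ 2.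

(* Main.v *)
Require Import Defs.
From mathcomp Require Import all_boot all_order all_algebra.
From mathcomp Require Import complex boolp reals.
From mathcomp Require Import mpoly.
From mathcomp Require Import zify ring lra.

Set Implicit Arguments.
Unset Strict Implicit.
Unset Printing Implicit Defensive.

Import Order.TTheory GRing.Theory Num.Theory.
Local Open Scope ring_scope.

(** Since [J = 0], the four real roots of [F] are harmonic, so
    [F = 4 u v (u^2 - v^2)] for real linear forms [u], [v]: with [Z = u + i v],
    [F] is the imaginary part of [Z^4].  Let [V] be the covolume of the lattice
    of values of [Z].  Irreducibility gives [|Z| >= 1] at nonzero points, hence
    [V^2 >= 3/4] by Hermite's bound.

    A solution is close to one of the four lines on which [F] vanishes, and
    rotating by 45 degrees makes it the line [v = 0].  Two solutions near that
    line satisfy the gap principle [u' >= c V u^3].  If there were four, the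
    third one, [W], would be so large that the diagonal Pade approximants of
    the fourth root rule out the fourth one, [T].  With [X = Re W^4], these are
    [U_0 = W], [U_1 = W (X - i F / 4)], [U_{n+1} = X U_n + lam_n F^2 U_{n-1}].
    Along rotations [U_n' = - kap_n F U_{n-1}], so the imaginary part of [U_n]
    vanishes to order [2 n + 1] on the line; on the other hand
    [Im (conj T * U_n)] is [V] times a rational number of controlled
    denominator, because [(u^2 + v^2)^2] is, up to a constant, the Hessian
    of [F], which is a constant times the square of an integral quadratic form.
    So each line carries at most three solutions. *)

(** Put x = W^4. The number conj x / x = 1 - 2 i F / x is close to 1, the approximants are those of
    its fourth root conj W / W, and U_n is W times a rescaled Pade numerator. Let N_n = Im (conj T *
    U_n). If N_n is nonzero, the arithmetic gives |N_n| >= V / (128 V^2)^n, while |N_n| <= u' |Im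
    U_n| + |v'| |Re U_n|. When the second term takes at most half of the lower bound, the first must
    supply the rest, which says u' e^n >= 19/10 V u^3 with a fixed e <= 1/2. Such a bound at one
    index n >= 1 controls the second term at the next two indices. As N_n cannot vanish twice in a
    row, the bound propagates to every n, which is absurd because e^n tends to 0. From index 0 only
    index 1 can be reached, so N_1 needs a separate argument. *)

(** * Divisibility of a quartic analogue of the falling factorial *)

Lemma logn2_fact_le n : (logn 2 n`! <= n)%N.
Proof.
rewrite logn_fact //.
(* The term [n %/ 2 ^ m] is a reserve: half of it pays for the next summand and the other half is
   the next reserve. *)
suff H m : (\sum_(1 <= k < m.+1) n %/ 2 ^ k + n %/ 2 ^ m <= n)%N.
  exact: leq_trans (leq_addr _ _) (H n).
elim: m => [|m IHm]; first by rewrite big_geq // divn1.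
rewrite big_nat_recr //=; apply: leq_trans IHm.
rewrite -addnA leq_add2l addnn expnSr divnMA -muln2.
exact: leq_divM.
Qed.

(** The prime 2 divides l! at most [l] times. Modulo the odd part [o] of l!, 4 has an inverse [u],
    and multiplying each factor by [u] turns the product into the falling factorial of [r + u], a
    multiple of l!. *)
Lemma fact_dvdn_prod l r : (l <= r)%N ->
  (l`! %| 2 ^ l * \prod_(i < l) (4 * (r - i) + 1))%N.
Proof.
move=> lr.
rewrite -[X in (X %| _)%N](@partnC 2%N l`!) ?fact_gt0 //.
apply: dvdn_mul; first by rewrite p_part dvdn_exp2l // logn2_fact_le.
set o := (l`!`_2^')%N.
have o_gt0 : (0 < o)%N by rewrite /o part_gt0.
have co4 : coprime 4 o.
  rewrite (@coprime_pexpl 2 2) // prime_coprime // -p'natE //; exact: part_pnat.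
have [[u m] /= um] := coprimeP o (isT : (0 < 4)%N) co4.
have {}um : (u * 4 = 1 + m * o)%N by lia.
have cou : coprime o (u ^ l).
  rewrite coprimeXr // coprime_sym; apply/coprimeP; first by case: (u) um => //; lia.
  by exists (4%N, m) => /=; lia.
rewrite -(Gauss_dvdr _ cou).
have odvd : (o %| l`!)%N by rewrite /o dvdn_part.
have modE : (u ^ l * \prod_(i < l) (4 * (r - i) + 1) = (r + u) ^_ l %[mod o])%N.
  rewrite ffact_prod -[X in (u ^ X * _)%N](card_ord l) -prod_nat_const -big_split /=.
  elim/big_ind2: _ => // [x1 x2 y1 y2 H1 H2|i _].
    by rewrite -modnMm H1 H2 modnMm.
  have il := ltn_ord i.
  have -> : (u * (4 * (r - i) + 1) = r + u - i + (m * (r - i)) * o)%N.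
    have -> : (u * (4 * (r - i) + 1) = (u * 4) * (r - i) + u)%N by lia.
    rewrite um; nia.
  by rewrite addnC modnMDl.
rewrite /dvdn modE; apply: dvdn_trans odvd _.
by rewrite -bin_ffact dvdn_mull.
Qed.

(** * The recurrence and its closed form *)

Section Recurrence.
Variables (A : comNzRingType) (c : nat -> A) (X G y0 y1 : A).
Fixpoint rec2 n : A :=
  match n with
  | 0 => y0
  | n1.+1 => match n1 with
             | 0 => y1
             | n2.+1 => X * rec2 n1 + c n1 * G * rec2 n2
             end
  end.
Lemma rec2SS n : rec2 n.+2 = X * rec2 n.+1 + c n.+1 * G * rec2 n.
Proof. by []. Qed.
End Recurrence.

Ltac nz_side := repeat (apply/andP; split); try assumption; apply: lt0r_neq0; lra.

Arguments rec2 : simpl never.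

Section ClosedForm.
Variable R : realFieldType.

(** This is what remains of the last coefficient of [ppoly_rec] after dividing the polynomials by
    the central binomial coefficients, a normalization that turns the middle coefficient into
    [X]. *)
Definition lam (n : nat) : R := (16 * n%:R ^+ 2 - 1) / (16 * (4 * n%:R ^+ 2 - 1)).

Definition gbin (r l : nat) : R :=
  (\prod_(i < l) (r%:R + 4^-1 - i%:R)) / l`!%:R.

(* [(-1)^l C(2r-l, r) C(r+1/4, l)], the coefficients of the numerator of the
   diagonal Pade approximant of [(1 - z)^(1/4)]. *)
Definition pcoef (r l : nat) : R :=
  if (l <= r)%N then
    (-1) ^+ l * (2 * r - l)`!%:R / (r`!%:R * (r - l)`!%:R) * gbin r l
  else 0.

Lemma gbin0 r : gbin r 0 = 1.
Proof. by rewrite /gbin big_ord0 fact0 divr1. Qed.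

Lemma gbinSr r l : gbin r l.+1 = gbin r l * (r%:R + 4^-1 - l%:R) / l.+1%:R.
Proof.
rewrite /gbin big_ord_recr /= factS natrM.
have h1 : (l.+1%:R : R) != 0 by rewrite pnatr_eq0.
have h2 : (l`!%:R : R) != 0 by rewrite pnatr_eq0 -lt0n fact_gt0.
by have l0 := ler0n R l; field; nz_side.
Qed.

Lemma gbinSS r l : gbin r.+1 l.+1 = gbin r l * (r%:R + 1 + 4^-1) / l.+1%:R.
Proof.
rewrite /gbin big_ord_recl /= factS natrM.
rewrite (eq_bigr (fun i : 'I_l => r%:R + 4^-1 - i%:R)); last first.
  by move=> i _; rewrite /bump /= add1n -!natr1; ring.
have h1 : (l.+1%:R : R) != 0 by rewrite pnatr_eq0.
have h2 : (l`!%:R : R) != 0 by rewrite pnatr_eq0 -lt0n fact_gt0.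
rewrite -[r.+1%:R]natr1; by have l0 := ler0n R l; field; nz_side.
Qed.

Lemma pcoef_rec0 r : (r.+1%:R) * pcoef r.+1 0 = (2 * r%:R + 1) * (2 * pcoef r 0).
Proof.
rewrite /pcoef !leq0n !gbin0 !subn0 !expr0 mulnS !factS !natrM.
have h1 : (r.+1%:R : R) != 0 by rewrite pnatr_eq0.
have h2 : (r`!%:R : R) != 0 by rewrite pnatr_eq0 -lt0n fact_gt0.
rewrite [(2 * r).+2%:R](_ : _ = 2 * r.+1%:R); last by rewrite -natrM; congr (_%:R); lia.
rewrite [(2 * r).+1%:R](_ : _ = 2 * r%:R + 1); last by rewrite -natr1 natrM.
by have r0 := ler0n R r; field; nz_side.
Qed.

Lemma pcoef_rec1 r : (r.+2%:R) * pcoef r.+2 1 =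
  (2 * r.+1%:R + 1) * (2 * pcoef r.+1 1 - pcoef r.+1 0).
Proof.
rewrite /pcoef !leq0n !ltnS !leq0n !gbinSr !gbin0 !subn0 !expr0 expr1.
have -> : (2 * r.+2 - 1 = (2 * r).+3)%N by lia.
have -> : (2 * r.+1 - 1 = (2 * r).+1)%N by lia.
have -> : (2 * r.+1 = (2 * r).+2)%N by lia.
have -> : (r.+2 - 1 = r.+1)%N by lia.
have -> : (r.+1 - 1 = r)%N by lia.
have h2 : (r`!%:R : R) != 0 by rewrite pnatr_eq0 -lt0n fact_gt0.
have r0 : 0 <= r%:R :> R by rewrite ler0n.
rewrite !factS !natrM -![_.+3%:R]natr1 -![_.+2%:R]natr1 -![_.+1%:R]natr1 !natrM.
by field; nz_side.
Qed.

Lemma pcoef_recSS m d : let r := (m + d)%N in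
  (r.+2%:R) * pcoef r.+2 m.+2 =
  (2 * r.+1%:R + 1) * (2 * pcoef r.+1 m.+2 - pcoef r.+1 m.+1)
  - (16 * r.+1%:R ^+ 2 - 1) / (16 * r.+1%:R) * pcoef r m.
Proof.
move=> r.
(* The extra factor [d%:R] lets one formula cover [d = 0], where the index exceeds the degree and
   [pcoef] is 0 by definition. *)
have E1 : pcoef r.+1 m.+2 = (-1) ^+ m * ((m + 2 * d)`!%:R * d%:R) / (r.+1`!%:R * d`!%:R) * gbin r.+1 m.+2.
  rewrite /pcoef; case: d @r => [|d] r.
    by rewrite ltnNge leq_eqVlt /r addn0 eqxx /= mulr0 mulr0 mul0r mul0r.
  have -> : (m.+2 <= r.+1)%N by rewrite /r; lia.
  have -> : (2 * r.+1 - m.+2 = m + 2 * d.+1)%N by rewrite /r; lia.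
  have -> : (r.+1 - m.+2 = d)%N by rewrite /r; lia.
  rewrite (factS d) (natrM _ d.+1) !exprS.
  have h1 : (d.+1%:R : R) != 0 by rewrite pnatr_eq0.
  have h2 : (d`!%:R : R) != 0 by rewrite pnatr_eq0 -lt0n fact_gt0.
  have h3 : (r.+1`!%:R : R) != 0 by rewrite pnatr_eq0 -lt0n fact_gt0.
  have d0 := ler0n R d; move: ((m + _)`!%:R) => N; by field; nz_side.
rewrite E1 /pcoef {E1}.
have -> : (m.+2 <= r.+2)%N by rewrite /r; lia.
have -> : (m.+1 <= r.+1)%N by rewrite /r; lia.
have -> : (m <= r)%N by rewrite /r; lia.
have -> : (2 * r.+2 - m.+2 = (m + 2 * d).+2)%N by rewrite /r; lia.
have -> : (2 * r.+1 - m.+1 = (m + 2 * d).+1)%N by rewrite /r; lia.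
have -> : (2 * r - m = (m + 2 * d))%N by rewrite /r; lia.
have -> : (r.+2 - m.+2 = d)%N by rewrite /r; lia.
have -> : (r.+1 - m.+1 = d)%N by rewrite /r; lia.
have -> : (r - m = d)%N by rewrite /r; lia.
rewrite (gbinSr r.+1 m.+1) 2!gbinSS !exprS.
have h1 : (r`!%:R : R) != 0 by rewrite pnatr_eq0 -lt0n fact_gt0.
have h2 : (d`!%:R : R) != 0 by rewrite pnatr_eq0 -lt0n fact_gt0.
have m0 : 0 <= m%:R :> R by rewrite ler0n.
have d0 : 0 <= d%:R :> R by rewrite ler0n.
rewrite !factS !natrM -![_.+2%:R]natr1 -![_.+1%:R]natr1 /r !natrD ?natrM.
move: (gbin _ _) ((m + 2 * d)`!%:R : R) ((-1) ^+ m) (d`!%:R) h2 (m + d)`!%:R h1 => g N s D D0 P P0.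
by field; nz_side.
Qed.

Definition ppoly r : {poly R} := \poly_(l < r.+1) pcoef r l.

Lemma ppoly_coef r l : (ppoly r)`_l = pcoef r l.
Proof. by rewrite coef_poly ltnS /pcoef; case: leqP. Qed.

(** Up to a central binomial coefficient, [ppoly r] is the hypergeometric polynomial 2F1(-r, -r -
    1/4; -2r; z), and this is a contiguous relation in [r]. It is checked in degrees 0, 1 and at
    least 2 separately. *)
Lemma ppoly_rec r :
  r.+2%:R *: ppoly r.+2 = (2 * r.+1%:R + 1) *: ((2 - 'X) * ppoly r.+1)
     - ((16 * r.+1%:R ^+ 2 - 1) / (16 * r.+1%:R)) *: ('X ^+ 2 * ppoly r).
Proof.
apply/polyP => l.
rewrite coefB !coefZ mulrBl coefB -polyC_natr coefCM coefXM coefXnM !ppoly_coef.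
case: l => [|[|m]] /=.
- by rewrite pcoef_rec0; ring.
- by rewrite pcoef_rec1; ring.
rewrite !subn2 /=; case: (leqP m r) => mr.
  by rewrite -(subnKC mr) pcoef_recSS.
have [-> -> -> ->] : [/\ pcoef r.+2 m.+2 = 0, pcoef r.+1 m.+2 = 0,
    pcoef r.+1 m.+1 = 0 & pcoef r m = 0].
  by rewrite /pcoef; split; rewrite ifF //; lia.
by ring.
Qed.
End ClosedForm.

(** * Arithmetic of the approximants *)

Section Rec2Theory.
Variables (A : comNzRingType) (c : nat -> A) (X G : A).

Lemma rec2_ind (P : nat -> A -> Prop) y0 y1 : P 0%N y0 -> P 1%N y1 ->
  (forall n a b, P n a -> P n.+1 b -> P n.+2 (X * b + c n.+1 * G * a)) ->
  forall n, P n (rec2 c X G y0 y1 n).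
Proof.
move=> P0 P1 PS n.
suff [] : P n (rec2 c X G y0 y1 n) /\ P n.+1 (rec2 c X G y0 y1 n.+1) by [].
by elim: n => [//|n [IH1 IH2]]; split=> //; rewrite rec2SS; apply: PS.
Qed.

Lemma rec2_lin p q y0 y1 z0 z1 n :
  rec2 c X G (p * y0 + q * z0) (p * y1 + q * z1) n =
  p * rec2 c X G y0 y1 n + q * rec2 c X G z0 z1 n.
Proof.
suff [] : rec2 c X G (p * y0 + q * z0) (p * y1 + q * z1) n =
  p * rec2 c X G y0 y1 n + q * rec2 c X G z0 z1 n /\
  rec2 c X G (p * y0 + q * z0) (p * y1 + q * z1) n.+1 =
  p * rec2 c X G y0 y1 n.+1 + q * rec2 c X G z0 z1 n.+1 by [].
elim: n => [//|n [IH1 IH2]]; split=> //.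
by rewrite !rec2SS IH1 IH2; ring.
Qed.
End Rec2Theory.

Section Integrality.
Variable R : realType.
Local Notation C := R[i]%C.
Local Notation lamC := (fun n => (lam R n)%:C%C).

(** The factorials form a binomial coefficient. In [8 ^+ l], the factor 4^l clears the quarters in
    [gbin] and 2^l is the power needed in [fact_dvdn_prod]. *)
Lemma pcoef_int r l : 8 ^+ l * pcoef R r l \is a Num.int.
Proof.
rewrite /pcoef; case: leqP => lr; last by rewrite mulr0 rpred0.
rewrite -[(-1) ^+ l * _ / _]mulrA.
have -> : (2 * r - l)`!%:R / (r`!%:R * (r - l)`!%:R) = 'C(2 * r - l, r)%:R :> R.
  have h1 : (r`!%:R : R) != 0 by rewrite pnatr_eq0 -lt0n fact_gt0.
  have h2 : ((r - l)`!%:R : R) != 0 by rewrite pnatr_eq0 -lt0n fact_gt0.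
  rewrite -(@bin_fact (2 * r - l) r); last by lia.
  have -> : (2 * r - l - r = r - l)%N by lia.
  by rewrite !natrM mulfK // mulf_neq0.
suff H : 8 ^+ l * gbin R r l \is a Num.int.
  rewrite (_ : _ * _ = ((-1) ^+ l * 'C(2 * r - l, r)%:R) * (8 ^+ l * gbin R r l));
    last by ring.
  by rewrite rpredM // rpredM // ?rpredX ?rpredN ?rpred1 // rpred_nat.
have /dvdnP[q Hq] := fact_dvdn_prod lr.
have h1 : (l`!%:R : R) != 0 by rewrite pnatr_eq0 -lt0n fact_gt0.
rewrite /gbin mulrA (_ : 8 ^+ l * _ = q%:R * l`!%:R).
  by rewrite mulfK // rpred_nat.
rewrite -natrM -Hq natrM natrX natr_prod (_ : 8 = 2 * 4 :> R); last by ring.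
rewrite exprMn -mulrA; congr (_ * _).
rewrite -[X in _ ^+ X](card_ord l) -prodr_const -big_split /=.
apply: eq_bigr => i _; have il := ltn_ord i.
rewrite natrD natrM natrB; last by lia.
by field.
Qed.

Lemma binS_central n :
  (n.+1 * 'C(2 * n.+1, n.+1) = 2 * (2 * n + 1) * 'C(2 * n, n))%N.
Proof.
apply/eqP; rewrite -(eqr_nat R) !natrM natrD natrM; apply/eqP.
have := pcoef_rec0 R n; rewrite /pcoef !leq0n !gbin0 !subn0 !expr0.
have B k : (2 * k)`!%:R / (k`!%:R * k`!%:R) = 'C(2 * k, k)%:R :> R.
  have h1 : (k`!%:R : R) != 0 by rewrite pnatr_eq0 -lt0n fact_gt0.
  rewrite -(@bin_fact (2 * k) k); last by lia.
  have -> : (2 * k - k = k)%N by lia.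
  by rewrite !natrM mulfK // mulf_neq0.
by rewrite !mul1r !mulr1 !B => ->; ring.
Qed.

(* [U_r / W] for [x = W^4] and [f = 2 i F]. *)
Definition psiC (x f : C) r := rec2 lamC (x - f / 2) (- f ^+ 2 / 4) 1 (x - 5 * f / 8) r.

(** With x = X + i F and f = 2 i F one has 1 - f / x = conj x / x, so f / x is the right argument
    for an approximant of the fourth root of 1 - z; the power of x clears denominators. The closed
    form is needed for integrality, the recurrence for everything else. *)
Lemma psiC_closed (x f : C) r : x != 0 ->
  'C(2 * r, r)%:R * psiC x f r = x ^+ r * (map_poly (real_complex R) (ppoly R r)).[f / x].
Proof.
move=> x0.
suff [] : 'C(2 * r, r)%:R * psiC x f r = x ^+ r * (map_poly (real_complex R) (ppoly R r)).[f / x]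
  /\ 'C(2 * r.+1, r.+1)%:R * psiC x f r.+1 =
   x ^+ r.+1 * (map_poly (real_complex R) (ppoly R r.+1)).[f / x] by [].
elim: r => [|r [IH1 IH2]].
  split.
    have -> : ppoly R 0 = 1%:P.
      apply/polyP => i; rewrite ppoly_coef coefC /pcoef leqn0.
      case: eqP => [->|//]; rewrite gbin0 /= fact0; by field.
    by rewrite map_polyC hornerC /psiC /rec2 /= ?mulr1 ?mul1r.
  have -> : ppoly R 1 = 2%:P - (5 / 4) *: 'X.
    apply/polyP => -[|[|i]]; rewrite ppoly_coef coefB coefC coefZ coefX /pcoef //=; last by rewrite mulr0 subr0.
    - by rewrite gbin0 [(2 * 1 - 0)`!](_ : _ = 2%N) // [(1 - 0)`!](_ : _ = 1%N) //; field.
    - by rewrite gbinSr gbin0 [(2 * 1 - 1)`!](_ : _ = 1%N) // [(1 - 1)`!](_ : _ = 1%N) //; field.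
  rewrite rmorphB /= map_polyC map_polyZ map_polyX hornerD hornerN hornerC hornerZ hornerX.
  rewrite /psiC /rec2 /= (_ : 'C(2 * 1, 1) = 2)%N // expr1.
  rewrite fmorph_div /= !rmorph_nat; by field.
split=> //.
have n0 : r.+2%:R != 0 :> C by rewrite pnatr_eq0.
apply: (mulfI n0); rewrite mulrA mulrCA.
have -> : (r.+2%:R * (map_poly (real_complex R) (ppoly R r.+2)).[f / x]) =
  (map_poly (real_complex R) (r.+2%:R *: ppoly R r.+2)).[f / x].
  by rewrite map_polyZ hornerZ rmorph_nat.
have map2X : map_poly (real_complex R) (2 - 'X) = 2 - 'X.
  by rewrite rmorphB /= map_polyX rmorph_nat.
rewrite ppoly_rec rmorphB /= !map_polyZ (rmorphM _ (2 - 'X)) /= map2X.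
rewrite (rmorphM _ ('X ^+ 2)) /= map_polyXn hornerD hornerN !hornerZ
  (hornerM (2 - 'X)) (hornerM 'X^2) hornerXn.
rewrite hornerD hornerN hornerX -polyC_natr hornerC.
move: IH1 IH2; set P0 := (_.[_]); set P1 := (map_poly _ (ppoly R r.+1)).[_] => IH1 IH2.
rewrite -[r.+2%:R * _%:R]natrM binS_central.
have n1 : r.+1%:R != 0 :> C by rewrite pnatr_eq0.
have n1' : 1 + r%:R != 0 :> C by rewrite addrC natr1 pnatr_eq0.
have -> : x ^+ r.+2 * ((real_complex R) (2 * r.+1%:R + 1) * ((2 - f / x) * P1) -
   (real_complex R) ((16 * r.+1%:R ^+ 2 - 1) / (16 * r.+1%:R)) * ((f / x) ^+ 2 * P0)) =
   (real_complex R) (2 * r.+1%:R + 1) * (2 * x - f) * (x ^+ r.+1 * P1)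
   - (real_complex R) ((16 * r.+1%:R ^+ 2 - 1) / (16 * r.+1%:R)) * f ^+ 2 * (x ^+ r * P0).
  by rewrite !exprS; field; rewrite x0 n1'.
rewrite -IH1 -IH2 /psiC rec2SS.
move: (rec2 _ _ _ _ _ r) (rec2 _ _ _ _ _ r.+1) => A B.
have E : 'C(2 * r.+1, r.+1)%:R = 2 * (2 * r%:R + 1) * 'C(2 * r, r)%:R / r.+1%:R :> C.
  by apply: (mulIf n1); rewrite mulfVK // mulrC -[r.+1%:R * _]natrM binS_central !natrM natrD natrM.
rewrite !natrM natrD natrM E /lam.
field; rewrite n1' /=.
have -> : 4 * (1 + r%:R) ^+ 2 - 1 = (4 * r ^ 2 + 8 * r + 3)%:R :> C.
  by rewrite !natrD !natrM; ring.
by rewrite pnatr_eq0; lia.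
Qed.

(** This is the additive group Z + Z i D, which is a ring once [D ^+ 2] is an integer. *)
Definition in_order (D : R) (z : C) := exists a b : R,
  [/\ a \is a Num.int, b \is a Num.int & z = (a +i* (b * D))%C].

Lemma in_order_int D a : a \is a Num.int -> in_order D (a%:C)%C.
Proof. by move=> aZ; exists a, 0; rewrite mul0r; split=> //; rewrite rpred0. Qed.

Lemma in_orderD D z1 z2 : in_order D z1 -> in_order D z2 -> in_order D (z1 + z2).
Proof.
move=> [a1 [b1 [a1Z b1Z ->]]] [a2 [b2 [a2Z b2Z ->]]].
exists (a1 + a2), (b1 + b2); rewrite !rpredD //; split=> //.
by simpc; rewrite mulrDl.
Qed.

Lemma in_orderM D z1 z2 : D ^+ 2 \is a Num.int ->
  in_order D z1 -> in_order D z2 -> in_order D (z1 * z2).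
Proof.
move=> DZ [a1 [b1 [a1Z b1Z ->]]] [a2 [b2 [a2Z b2Z ->]]].
exists (a1 * a2 - b1 * b2 * D ^+ 2), (a1 * b2 + b1 * a2).
split.
- by apply: rpredB; apply: rpredM => //; apply: rpredM.
- by apply: rpredD; apply: rpredM.
by simpc; congr (_ +i* _)%C; ring.
Qed.

Lemma in_orderX D z n : D ^+ 2 \is a Num.int -> in_order D z -> in_order D (z ^+ n).
Proof.
move=> DZ zO; elim: n => [|n IHn]; last by rewrite exprS; apply: in_orderM.
by rewrite expr0; apply: (@in_order_int D 1); rewrite rpred1.
Qed.

Lemma psiC_in_order (D X F : R) r :
  0 < D -> D ^+ 2 \is a Num.int -> 2 * D * X \is a Num.int ->
  F \is a Num.int -> F != 0 ->
  in_order D (((4 * D) ^+ r)%:C%C * ('C(2 * r, r)%:R *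
     psiC (X +i* F)%C (0 +i* (2 * F))%C r)).
Proof.
move=> D0 DZ XZ FZ F0.
set x := (X +i* F)%C; set f := (0 +i* (2 * F))%C.
have x0 : x != 0 by rewrite eq_complex /= negb_and F0 orbT.
rewrite psiC_closed // (@horner_coef_wide _ r.+1); last first.
  by rewrite size_map_poly size_poly.
rewrite !mulr_sumr; elim/big_ind: _ => [||l _].
- by apply: (@in_order_int D 0); rewrite rpred0.
- exact: in_orderD.
have lr : (l <= r)%N by rewrite -ltnS.
rewrite coef_map ppoly_coef /=.
(* In the term of index l, [r - l] of the factors 4 D go to x, as 2 times the order element 2 D x,
   and the other l go to f, as 8 times i D F; the resulting 8^l clears [pcoef]. *)
have -> : ((4 * D) ^+ r)%:C%C * (x ^+ r * ((pcoef R r l)%:C%C * (f / x) ^+ l)) =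
  (2 ^+ (r - l))%:C%C * (8 ^+ l * pcoef R r l)%:C%C *
  ((F%:C%C * (0 +i* (1 * D))%C) ^+ l * ((2 * D)%:C%C * x) ^+ (r - l)).
  have -> : f = 2 * (F%:C%C * 'i%C) by rewrite /f; simpc.
  have -> : (0 +i* (1 * D))%C = D%:C%C * 'i%C by simpc.
  have e (z : C) : z ^+ r = z ^+ (r - l) * z ^+ l by rewrite -exprD subnK.
  have xl0 : x ^+ l != 0 by rewrite expf_eq0 negb_and x0 orbT.
  have e4 : 4 = 2 * 2 :> C by ring.
  have e8 : 8 = 2 * 2 * 2 :> C by ring.
  rewrite !(rmorphM, rmorphXn) /= !rmorph_nat (e x) (e (4 * _)) e4 e8 !exprMn exprVn.
  by field.
apply: in_orderM => //.
  apply: in_orderM => //; apply: in_order_int; last exact: pcoef_int.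
  by rewrite rpredX // rpred_nat.
apply: in_orderM => //; apply: in_orderX => //.
  apply: in_orderM => //; first exact: in_order_int.
  by exists 0, 1; split; rewrite ?rpred0 ?rpred1.
exists (2 * D * X), (2 * F); split=> //; first by rewrite rpredM // rpred_nat.
by rewrite /x; simpc; congr (_ +i* _)%C; ring.
Qed.

Lemma rec2_complex (X G y0 y1 z0 z1 : R) n :
  rec2 lamC X%:C%C G%:C%C (y0 +i* z0)%C (y1 +i* z1)%C n =
  (rec2 (lam R) X G y0 y1 n +i* rec2 (lam R) X G z0 z1 n)%C.
Proof.
suff [] : rec2 lamC X%:C%C G%:C%C (y0 +i* z0)%C (y1 +i* z1)%C n =
  (rec2 (lam R) X G y0 y1 n +i* rec2 (lam R) X G z0 z1 n)%C /\
  rec2 lamC X%:C%C G%:C%C (y0 +i* z0)%C (y1 +i* z1)%C n.+1 =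
  (rec2 (lam R) X G y0 y1 n.+1 +i* rec2 (lam R) X G z0 z1 n.+1)%C by [].
elim: n => [//|n [IH1 IH2]]; split=> //.
by rewrite !rec2SS IH1 IH2; simpc.
Qed.

(** The sequence is the imaginary part of (p + i m) psi. Integrality of [D * p], rather than of [p],
    is enough because the imaginary part of the scaled psi is a multiple of D. *)
Lemma rec2_int (D X F m p : R) r :
  0 < D -> D ^+ 2 \is a Num.int -> 2 * D * X \is a Num.int ->
  F \is a Num.int -> F != 0 -> m \is a Num.int -> D * p \is a Num.int ->
  (4 * D) ^+ r * 'C(2 * r, r)%:R *
    rec2 (lam R) X (F ^+ 2) m (m * X - p * F / 4) r \is a Num.int.
Proof.
move=> D0 DZ XZ FZ F0 mZ pZ.
have [a [b [aZ bZ]]] := psiC_in_order r D0 DZ XZ FZ F0.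
rewrite /psiC.
have -> : (X +i* F)%C - (0 +i* (2 * F))%C / 2 = X%:C%C.
  have -> : 2 = (2 : R)%:C%C by rewrite rmorph_nat.
  by rewrite -fmorphV /=; simpc; congr (_ +i* _)%C; field.
have -> : - (0 +i* (2 * F))%C ^+ 2 / 4 = (F ^+ 2)%:C%C.
  have -> : 4 = (4 : R)%:C%C by rewrite rmorph_nat.
  by rewrite -fmorphV /= expr2; simpc; congr (_ +i* _)%C; field.
have -> : (X +i* F)%C - 5 * (0 +i* (2 * F))%C / 8 = (X +i* (- F / 4))%C.
  have -> : 5 = (5 : R)%:C%C by rewrite rmorph_nat.
  have -> : 8 = (8 : R)%:C%C by rewrite rmorph_nat.
  by rewrite -fmorphV /=; simpc; congr (_ +i* _)%C; field.
rewrite (rec2_complex _ _ 1 _ 0).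
have -> : 'C(2 * r, r)%:R = ('C(2 * r, r)%:R : R)%:C%C by rewrite rmorph_nat.
simpc => -[E1 E2].
have -> : rec2 (lam R) X (F ^+ 2) m (m * X - p * F / 4) r =
  m * rec2 (lam R) X (F ^+ 2) 1 X r + p * rec2 (lam R) X (F ^+ 2) 0 (- F / 4) r.
  rewrite -rec2_lin; congr (rec2 _ _ _ _ _ _); ring.
rewrite (_ : _ * _ = m * a + (D * p) * b); last first.
  rewrite (_ : D * p * b = p * (b * D)); last by ring.
  by rewrite -E1 -E2 mulNr; ring.
by apply: rpredD; apply: rpredM.
Qed.
End Integrality.

(** * Vanishing of the imaginary part *)

Section SinePart.
Variable R : realFieldType.

(** [Xp] and [Fp] are the real and imaginary parts of (1 + i v)^4 with v the indeterminate, and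
    [Ip n] is Im U_n at u = 1, dehomogenized from degree 4 n + 1. *)
Definition Xp : {poly R} := 1 - 6 * 'X ^+ 2 + 'X ^+ 4.
Definition Fp : {poly R} := 4 * 'X - 4 * 'X ^+ 3.
Definition Ip n : {poly R} :=
  rec2 (fun n => (lam R n)%:P) Xp (Fp ^+ 2) 'X ('X ^+ 5 - 5 * 'X ^+ 3) n.
Definition kap (n : nat) : R := (16 * n%:R ^+ 2 - 1) / (4 * (2 * n%:R - 1)).
(* The rotation field [u d/dv - v d/du] on forms of degree [N], at [u = 1]. *)
Definition rotD (N : nat) (p : {poly R}) := (1 + 'X ^+ 2) * p^`() - N%:R * 'X * p.

Lemma rotDD N p q : rotD N (p + q) = rotD N p + rotD N q.
Proof. by rewrite /rotD derivD; ring. Qed.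

Lemma rotDM N M p q : rotD (N + M) (p * q) = rotD N p * q + p * rotD M q.
Proof. by rewrite /rotD derivM natrD; ring. Qed.

Lemma rotDC c : rotD 0 c%:P = 0.
Proof. by rewrite /rotD derivC; ring. Qed.

Lemma rotD_Xp : rotD 4 Xp = - 4 * Fp.
Proof.
rewrite /rotD /Xp /Fp !derivE /= -!polyC_natr ?derivC /=.
by rewrite !polyC_natr; ring.
Qed.

Lemma rotD_Fp : rotD 4 Fp = 4 * Xp.
Proof.
rewrite /rotD /Xp /Fp !derivE /= -!polyC_natr ?derivC /=.
by rewrite !polyC_natr; ring.
Qed.

(** This identity and [kap_lam2] match the coefficients of X F U_{n+1} and of F^3 U_n in the
    induction step of [rotD_Ip]. *)
Lemma kap_lam1 n : 4 + kap n.+2 - 8 * lam R n.+2 = kap n.+3.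
Proof.
rewrite /kap /lam -![_.+3%:R]natr1 -![_.+2%:R]natr1 -![_.+1%:R]natr1.
have n0 := ler0n R n.
have h : 0 <= n%:R ^+ 2 :> R by rewrite exprn_ge0.
by field; nz_side.
Qed.

Lemma kap_lam2 n : 4 * lam R n.+1 + lam R n.+2 * kap n.+1 = kap n.+3 * lam R n.+1.
Proof.
rewrite /kap /lam -![_.+3%:R]natr1 -![_.+2%:R]natr1 -![_.+1%:R]natr1.
have n0 := ler0n R n.
have h : 0 <= n%:R ^+ 2 :> R by rewrite exprn_ge0.
by field; nz_side.
Qed.

Lemma IpSS n : Ip n.+2 = Xp * Ip n.+1 + (lam R n.+1)%:P * Fp ^+ 2 * Ip n.
Proof. by []. Qed.

Lemma rotD_IpSS n : rotD (4 * n + 9) (Ip n.+2) =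
  - 4 * Fp * Ip n.+1 + Xp * rotD (4 * n + 5) (Ip n.+1) +
  (lam R n.+1)%:P * (8 * Xp * Fp * Ip n + Fp ^+ 2 * rotD (4 * n + 1) (Ip n)).
Proof.
rewrite IpSS rotDD.
have -> : (4 * n + 9 = 4 + (4 * n + 5))%N by lia.
rewrite rotDM.
have -> : (4 + (4 * n + 5) = 0 + (4 + (4 + (4 * n + 1))))%N by lia.
by rewrite -!mulrA !rotDM rotDC rotD_Xp rotD_Fp; ring.
Qed.

Lemma rotD_Ip n : rotD (4 * n + 5) (Ip n.+1) = - (kap n.+1)%:P * Fp * Ip n.
Proof.
suff [] : rotD (4 * n + 5) (Ip n.+1) = - (kap n.+1)%:P * Fp * Ip n /\
  rotD (4 * n + 9) (Ip n.+2) = - (kap n.+2)%:P * Fp * Ip n.+1 by [].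
elim: n => [|n [IH1 IH2]].
  have I0 : Ip 0 = 'X by [].
  have I1 : Ip 1 = 'X ^+ 5 - 5 * 'X ^+ 3 by [].
  have D0 : rotD 1 'X = 1 by rewrite /rotD derivX; ring.
  have D1 : rotD 5 (Ip 1) = - (kap 1)%:P * Fp * Ip 0.
    have -> : - (kap 1)%:P * Fp * Ip 0 = - (4 * (kap 1)%:P) * ('X - 'X ^+ 3) * Ip 0.
      by rewrite /Fp; ring.
    rewrite -polyC_natr -polyCM (_ : 4 * kap 1 = 15); last by rewrite /kap; field.
    rewrite I0 I1 /rotD derivB derivM derivXn derivXn -polyC_natr derivC /=.
    by rewrite !polyC_natr; ring.
  split=> //; rewrite (rotD_IpSS 0) D1 I0 (D0 : rotD (4 * 0 + 1) 'X = 1).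
  (* Scaling by 16 leaves only the integers 4 [kap 1] = 15, 4 [kap 2] = 21 and 16 [lam R 1] = 5, so
     that [ring] can conclude in the polynomial ring. *)
  apply: (@mulfI _ 16); first by rewrite -polyC_natr polyC_eq0 pnatr_eq0.
  set k1 := (kap 1)%:P; set k2 := (kap 2)%:P; set l1 := (lam R 1)%:P.
  have -> : 16 * (- 4 * Fp * Ip 1 + Xp * (- k1 * Fp * 'X) +
     l1 * (8 * Xp * Fp * 'X + Fp ^+ 2 * 1)) =
    Fp * (- 64 * Ip 1 - 4 * (4 * k1) * Xp * 'X + (16 * l1) * (8 * Xp * 'X + Fp)).
    by ring.
  have -> : 16 * (- k2 * Fp * Ip 1) = Fp * (- 4 * (4 * k2) * Ip 1) by ring.
  rewrite /k1 /k2 /l1 -!polyC_natr -!polyCM (_ : 4 * kap 1 = 15); last by rewrite /kap; field.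
  rewrite (_ : 4 * kap 2 = 21); last by rewrite /kap; field.
  rewrite (_ : 16 * lam R 1 = 5); last by rewrite /lam; field.
  by rewrite !polyC_natr !polyCM !polyC_natr I1 /Xp /Fp; ring.
split; first by have -> : (4 * n.+1 + 5 = 4 * n + 9)%N by lia.
have -> : (4 * n.+1 + 9 = 4 * n + 13)%N by lia.
have := rotD_IpSS n.+1.
have -> : (4 * n.+1 + 9 = 4 * n + 13)%N by lia.
have -> : (4 * n.+1 + 5 = 4 * n + 9)%N by lia.
have -> : (4 * n.+1 + 1 = 4 * n + 5)%N by lia.
rewrite IH1 IH2 => ->.
have E1 : (kap n.+3)%:P = 4 + (kap n.+2)%:P - 8 * (lam R n.+2)%:P.
  by rewrite -kap_lam1 polyCB polyCD (polyCM 8) !polyC_natr.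
have E2 : 4 * (lam R n.+1)%:P + (lam R n.+2)%:P * (kap n.+1)%:P = (kap n.+3)%:P * (lam R n.+1)%:P.
  by rewrite -!polyCM -kap_lam2 polyCD (polyCM 4) !polyC_natr.
rewrite (IpSS n); move: (kap n.+3)%:P (kap n.+2)%:P (kap n.+1)%:P (lam R n.+2)%:P (lam R n.+1)%:P E1 E2.
move: (Ip n.+1) (Ip n) => a b k3 k2 k1 l2 l1 E1 /(canRL (addKr _)) E2.
have -> : - 4 * Fp * (Xp * a + l1 * Fp ^+ 2 * b) + Xp * (- k2 * Fp * a) +
  l2 * (8 * Xp * Fp * a + Fp ^+ 2 * (- k1 * Fp * b)) =
  - 4 * Fp * (Xp * a + l1 * Fp ^+ 2 * b) + Xp * (- k2 * Fp * a) +
  l2 * (8 * Xp * Fp * a) - (l2 * k1) * Fp ^+ 3 * b by ring.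
by rewrite E2 E1; ring.
Qed.

Lemma rotD_coef N p i : (rotD N p)`_i =
  p`_i.+1 *+ i.+1 + (if (i <= 1)%N then 0 else p`_i.-1 *+ i.-1)
  - (if i is j.+1 then p`_j *+ N else 0).
Proof.
rewrite /rotD coefB mulrDl mul1r coefD coef_deriv coefXnM -mulrA -polyC_natr coefCM coefXM.
by case: i => [|[|i]] //=; rewrite ?coef_deriv ?mulr0 ?subn2 //= ?mulr_natl.
Qed.

(** The coefficient of degree i of [rotD N p] is (i + 1) p_{i+1} plus a multiple of p_{i-1}, so the
    vanishing climbs one degree at a time. *)
Lemma rotD_vanish N m (p : {poly R}) : p`_0 = 0 -> (forall i, (i < m)%N -> (rotD N p)`_i = 0) ->
  forall i, (i <= m)%N -> p`_i = 0.
Proof.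
move=> p0 H i; elim/ltn_ind: i => -[//|i] IH im.
have := H i im; rewrite rotD_coef.
have -> : (if (i <= 1)%N then 0 else p`_i.-1 *+ i.-1) = 0.
  by case: i IH im => [|[|i]] //= IH im; rewrite IH ?mul0rn //; lia.
have -> : (if i is j.+1 then p`_j *+ N else 0) = 0.
  by case: i IH im => [|i] //= IH im; rewrite IH ?mul0rn //; lia.
by move=> /eqP; rewrite addr0 subr0 mulrn_eq0 /= => /eqP.
Qed.

Lemma Ip_coef0 n : (Ip n)`_0 = 0.
Proof.
refine (@rec2_ind _ _ _ _ (fun _ (p : {poly R}) => p`_0 = 0) _ _ _ _ _ n) => [||k a b IHa IHb].
  by rewrite coefX.
  by rewrite coefB !coefXn -polyC_natr coefCM coefXn mulr0 subr0.
by rewrite coefD !coef0M IHa IHb; ring.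
Qed.

(* [rotD_Ip] expresses the derivative of [Ip n.+1] as a multiple of ['X * Ip n]
   and integrating gains one more order. *)
Lemma Ip_vanish n i : (i <= 2 * n)%N -> (Ip n)`_i = 0.
Proof.
elim: n i => [|n IHn] i le_i.
  by rewrite (_ : i = 0)%N ?coefX //; lia.
apply: (@rotD_vanish (4 * n + 5) (2 * n.+1) _ (Ip_coef0 _)) => // j ltj.
have Fe : Fp = 'X * (4 - 4 * 'X ^+ 2) by rewrite /Fp; ring.
rewrite rotD_Ip Fe.
rewrite (_ : - (kap n.+1)%:P * _ * _ = 'X * ((- (kap n.+1)%:P * (4 - 4 * 'X ^+ 2)) * Ip n));
  last by ring.
rewrite coefXM; case: j ltj => [//|j] ltj /=.
rewrite coefMr big1 // => k _; rewrite IHn ?mulr0 //.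
have := ltn_ord k; lia.
Qed.

(** * Coefficientwise majorants *)

Definition dominated (p q : {poly R}) := forall i, `|p`_i| <= q`_i.

Lemma dominatedD p1 p2 q1 q2 : dominated p1 q1 -> dominated p2 q2 ->
  dominated (p1 + p2) (q1 + q2).
Proof.
by move=> H1 H2 i; rewrite !coefD (le_trans (ler_normD _ _)) // lerD.
Qed.

Lemma dominatedM p1 p2 q1 q2 : dominated p1 q1 -> dominated p2 q2 ->
  dominated (p1 * p2) (q1 * q2).
Proof.
move=> H1 H2 i; rewrite !coefM (le_trans (ler_norm_sum _ _ _)) //.
by apply: ler_sum => j _; rewrite normrM ler_pM.
Qed.

Lemma dominatedN p q : dominated p q -> dominated (- p) q.
Proof. by move=> H i; rewrite coefN normrN. Qed.

Lemma dominatedC c d : `|c| <= d -> dominated c%:P d%:P.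
Proof. by move=> H i; rewrite !coefC; case: eqP => //; rewrite normr0. Qed.

Lemma dominatedX : dominated 'X 'X.
Proof. by move=> i; rewrite coefX ger0_norm. Qed.

Lemma dominatedXn n : dominated 'X^n 'X^n.
Proof. by move=> i; rewrite coefXn ger0_norm. Qed.

Lemma lam_bounds n : 0 <= lam R n.+1 <= 5 / 16.
Proof.
have n0 := ler0n R n.
have h : 0 <= n%:R ^+ 2 :> R by rewrite exprn_ge0.
rewrite /lam -![n.+1%:R]natr1; have d0 : 0 < 16 * (4 * (n%:R + 1) ^+ 2 - 1) :> R by nra.
by apply/andP; split; [apply: divr_ge0; last exact: (ltW d0) | rewrite ler_pdivrMr //]; nra.
Qed.

(** The constant 10 is the positive root of t^2 = 8 t + 20: the majorants of [Xp] and [Fp] both have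
    value 8 at 1, and 20 = 5/16 * 8^2. *)
Lemma Ip_dominated n : exists2 q, dominated (Ip n) q & q.[1] <= 10 ^+ n.
Proof.
have dN k : dominated (k%:R)%:P (k%:R)%:P by apply: dominatedC; rewrite ger0_norm.
refine (@rec2_ind _ _ _ _ (fun n (p : {poly R}) => exists2 q, dominated p q & q.[1] <= 10 ^+ n) _ _ _ _ _ n)
  => [||k a b [qa Ha La] [qb Hb Lb]].
- by exists 'X; [exact: dominatedX | rewrite hornerX expr0].
- exists ('X^5 + 5%:R%:P * 'X^3); last by rewrite expr1 hornerD hornerCM !hornerXn !expr1n; lra.
  apply: dominatedD; first exact: dominatedXn.
  by apply: dominatedN; rewrite -polyC_natr; apply: dominatedM => //; apply: dominatedXn.
exists ((1%:R%:P + 6%:R%:P * 'X^2 + 'X^4) * qb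
   + (5 / 16)%:P * (4%:R%:P * 'X + 4%:R%:P * 'X^3) ^+ 2 * qa).
  have dX := dominatedX; have dXn := dominatedXn.
  apply: dominatedD; apply: dominatedM => //.
    rewrite /Xp -polyC_natr -[1]/(1%:R%:P).
    apply: dominatedD => //; apply: dominatedD => //.
    by apply: dominatedN; apply: dominatedM.
  have /andP[l0 l1] := lam_bounds k.
  apply: dominatedM; first by apply: dominatedC; rewrite ger0_norm.
  rewrite !expr2; have dF : dominated Fp (4%:R%:P * 'X + 4%:R%:P * 'X^3).
    rewrite /Fp -polyC_natr; apply: dominatedD; first exact: dominatedM.
    by apply: dominatedN; apply: dominatedM.
  exact: dominatedM.
rewrite !(hornerD, hornerCM, hornerC, hornerXn, hornerX, hornerM) !expr1n.
move: La Lb; rewrite !exprS.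
by move: (10 ^+ k) => T; lra.
Qed.

Lemma dominated_horner p q m t : dominated p q -> `|t| <= 1 ->
  (forall i, (i < m)%N -> p`_i = 0) -> `|p.[t]| <= `|t| ^+ m * q.[1].
Proof.
move=> pq t1 p0; pose n := maxn (size p) (size q).
rewrite (@horner_coef_wide _ n p) ?leq_maxl // (@horner_coef_wide _ n q) ?leq_maxr //.
rewrite mulr_sumr (le_trans (ler_norm_sum _ _ _)) //; apply: ler_sum => i _.
rewrite normrM normrX expr1n mulr1.
case: (ltnP i m) => im.
  by rewrite p0 // normr0 mul0r mulr_ge0 ?exprn_ge0 // (le_trans _ (pq i)).
rewrite mulrC ler_pM ?exprn_ge0 //.
by rewrite -(subnK im) exprD ler_piMl ?exprn_ge0 ?exprn_ile1.
Qed.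

Lemma Ip_bound n t : `|t| <= 1 -> `|(Ip n).[t]| <= 10 ^+ n * `|t| ^+ (2 * n + 1).
Proof.
move=> t1; have [q Hq Lq] := Ip_dominated n.
apply: le_trans (dominated_horner Hq t1 (m := 2 * n + 1) _) _.
  by move=> i; rewrite addn1 ltnS; apply: Ip_vanish.
by rewrite mulrC ler_wpM2r // exprn_ge0.
Qed.

Lemma horner_Xp t : Xp.[t] = 1 - 6 * t ^+ 2 + t ^+ 4.
Proof. by rewrite /Xp -(polyC_natr _ 6) !(hornerD, hornerN, hornerCM, hornerC, hornerXn). Qed.

Lemma horner_Fp t : Fp.[t] = 4 * t - 4 * t ^+ 3.
Proof.
by rewrite /Fp -!(polyC_natr _ 4) !(hornerD, hornerN, hornerCM, hornerC, hornerXn, hornerX).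
Qed.

Lemma rec2_sin_bound (u v X F : R) n : 0 < u -> `|v| <= u ->
  X = u ^+ 4 - 6 * u ^+ 2 * v ^+ 2 + v ^+ 4 ->
  F = 4 * u * v * (u ^+ 2 - v ^+ 2) ->
  `|rec2 (lam R) X (F ^+ 2) v (v * X - u * F / 4) n|
    <= `|v| * (10 * u ^+ 2 * v ^+ 2) ^+ n.
Proof.
move=> u0 vu HX HF.
have un0 : u != 0 by rewrite gt_eqF.
have E k : rec2 (lam R) X (F ^+ 2) v (v * X - u * F / 4) k
  = u ^+ (4 * k + 1) * (Ip k).[v / u].
  suff [] : rec2 (lam R) X (F ^+ 2) v (v * X - u * F / 4) k
    = u ^+ (4 * k + 1) * (Ip k).[v / u] /\
    rec2 (lam R) X (F ^+ 2) v (v * X - u * F / 4) k.+1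
    = u ^+ (4 * k.+1 + 1) * (Ip k.+1).[v / u] by [].
  have XE : X = u ^+ 4 * Xp.[v / u].
    by rewrite HX horner_Xp; field.
  have FE : F = u ^+ 4 * Fp.[v / u].
    by rewrite HF horner_Fp; field.
  elim: k => [|k [IH1 IH2]].
    split; first by rewrite /Ip /rec2 hornerX; field.
    rewrite /Ip /rec2 HX HF -(polyC_natr _ 5) !(hornerD, hornerN, hornerCM, hornerXn).
    by field.
  split=> //; rewrite rec2SS IH1 IH2 (IpSS k).
  move: (Ip k) (Ip k.+1) (lam R k.+1) => A B l.
  rewrite (hornerD (Xp * B)) (hornerM Xp) (hornerM _ A) hornerCM horner_exp XE FE.
  have -> : (4 * k.+2 + 1 = 4 + (4 + (4 * k + 1)))%N by lia.
  have -> : (4 * k.+1 + 1 = 4 + (4 * k + 1))%N by lia.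
  rewrite (exprD u 4 (4 + (4 * k + 1))) (exprD u 4 (4 * k + 1)).
  by move: (Xp.[_]) (Fp.[_]) (A.[_]) (B.[_]) (u ^+ (4 * k + 1)) => *; ring.
rewrite E normrM (ger0_norm (exprn_ge0 _ (ltW u0))).
have t1 : `|v / u| <= 1 by rewrite normrM normfV (gtr0_norm u0) ler_pdivrMr // mul1r.
apply: (le_trans (ler_wpM2l (exprn_ge0 _ (ltW u0)) (Ip_bound n t1))).
rewrite normrM normfV (gtr0_norm u0) -(real_normK (num_real v)).
move: `|v| => w; rewrite le_eqVlt; apply/orP; left; apply/eqP.
have hu : u ^+ (2 * n + 1) != 0 by rewrite expf_eq0 (negPf un0) andbF.
have -> : (10 * u ^+ 2 * w ^+ 2) ^+ n = 10 ^+ n * u ^+ (2 * n) * w ^+ (2 * n).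
  by rewrite 2!exprMn (exprM u 2 n) (exprM w 2 n).
have -> : (w / u) ^+ (2 * n + 1) = w * w ^+ (2 * n) / u ^+ (2 * n + 1).
  by rewrite expr_div_n (exprD w (2 * n) 1) expr1 [w * _]mulrC.
have -> : (4 * n + 1 = 2 * n + (2 * n + 1))%N by lia.
rewrite (exprD u (2 * n) (2 * n + 1)).
by move: (u ^+ (2 * n + 1)) (u ^+ (2 * n)) (w ^+ (2 * n)) (10 ^+ n) hu => a b c d a0; field.
Qed.
End SinePart.

(** * The Pade argument *)

Lemma central_bin_le r : ('C(2 * r, r) <= 4 ^ r)%N.
Proof.
rewrite (_ : 4 = 2 ^ 2)%N // -expnM -[X in (_ <= X ^ _)%N]/(1 + 1)%N expnDn.
rewrite (bigD1 (inord r)) //= !exp1n !muln1 inordK ?leq_addr //; lia.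
Qed.

Lemma lam_gt0 (R : realFieldType) n : 0 < lam R n.+1.
Proof.
have n0 := ler0n R n.
have h : 0 <= n%:R ^+ 2 :> R by rewrite exprn_ge0.
by rewrite /lam -![n.+1%:R]natr1; apply: divr_gt0; nra.
Qed.

(** Each step multiplies this discrete Wronskian by [- (lam R n.+1 * G)]. It prevents two
    consecutive approximants from both being parallel to T. *)
Lemma casoratian_neq0 (R : realFieldType) (X G a0 a1 b0 b1 : R) n :
  G != 0 -> a0 * b1 - a1 * b0 != 0 ->
  rec2 (lam R) X G a0 a1 n * rec2 (lam R) X G b0 b1 n.+1 -
  rec2 (lam R) X G a0 a1 n.+1 * rec2 (lam R) X G b0 b1 n != 0.
Proof.
move=> G0 W0; elim: n => [//|n IHn].
rewrite 2!rec2SS.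
have -> : forall a b c d, a * (X * b + lam R n.+1 * G * d) - (X * a + lam R n.+1 * G * c) * b =
   - (lam R n.+1 * G) * (c * b - a * d) by move=> *; ring.
by rewrite mulf_neq0 // oppr_eq0 mulf_neq0 // gt_eqF // lam_gt0.
Qed.

(** The rate y + 1 works because y (y + 1) + 1 <= (y + 1)^2 and the coefficients [lam] are at most
    1. *)
Lemma rec2_growth (R : realFieldType) (u y X a1 : R) n : 0 <= u -> 0 <= y -> `|X| <= y ->
  `|a1| <= u * (y + 1) ->
  `|rec2 (lam R) X 1 u a1 n| <= u * (y + 1) ^+ n.
Proof.
move=> u0 y0 Xy a1y.
refine (@rec2_ind _ _ _ _ (fun n a => `|a| <= u * (y + 1) ^+ n) _ _ _ _ _ n) => [||k a b Ha Hb].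
- by rewrite expr0 mulr1 ger0_norm.
- by rewrite expr1.
have /andP[l0 l1] := lam_bounds R k.
rewrite mulr1 (le_trans (ler_normD _ _)) // (normrM X) (normrM (lam _ _)) (ger0_norm l0).
have H1 : `|X| * `|b| <= y * (u * (y + 1) ^+ k.+1) by apply: ler_pM.
have H2 : lam R k.+1 * `|a| <= 1 * (u * (y + 1) ^+ k).
  by apply: ler_pM => //; lra.
apply: le_trans (lerD H1 H2) _.
rewrite !exprS; set T := (y + 1) ^+ k.
have uT : 0 <= u * T by rewrite mulr_ge0 // exprn_ge0 // addr_ge0.
have -> : y * (u * ((y + 1) * T)) + 1 * (u * T) = (u * T) * (y * (y + 1) + 1) by ring.
have -> : u * ((y + 1) * ((y + 1) * T)) = (u * T) * ((y + 1) * (y + 1)) by ring.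
by apply: ler_wpM2l => //; nra.
Qed.

(** * Real inequalities for the Pade argument *)

Section NumericBounds.
Variable R : realFieldType.
Implicit Types u w a b c y : R.

Lemma pow4_ge u : 0 <= u -> 10 ^+ 5 <= u ^+ 4 -> 10 <= u.
Proof.
move=> u0; apply: contraTT; rewrite -!ltNge => ult.
have h2 : u ^+ 2 < 100 by nra.
have -> : u ^+ 4 = u ^+ 2 * u ^+ 2 by ring.
have h3 : 0 <= u ^+ 2 by rewrite sqr_ge0.
by move: (u ^+ 2) h2 h3 => c *; nra.
Qed.

Lemma small_of_cube u w : 0 <= w -> 10 <= u -> w * u ^+ 3 <= 13 / 50 -> w <= 1 / 100.
Proof.
move=> w0 u10.
have : 100 <= u ^+ 3 by rewrite (_ : u ^+ 3 = u * u * u); [nra | ring].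
by move: (u ^+ 3) => c; nra.
Qed.

Lemma sqr_small w : 0 <= w -> w <= 1 / 100 -> w ^+ 2 <= 1 / 100.
Proof. by move=> *; nra. Qed.

Lemma sqr_bound c : 0 <= c -> c <= 13 / 50 -> 10 * c ^+ 2 <= 169 / 250.
Proof. by move=> *; nra. Qed.

Lemma X_bound a b : 100 <= a -> 0 <= b -> b <= 1 / 100 ->
  `|a * a - 6 * (a * b) + b * b| <= a * a.
Proof.
move=> a1 b0 b1.
have ab0 : 0 <= a * b by nra.
have ab1 : a * b <= a by nra.
have bb : b * b <= a * b by nra.
by rewrite ler_norml; apply/andP; split; nra.
Qed.

(** Here a = V^2 and y = u^4. After scaling by (128 V^2)^n, e and H bound the rates of Im U_n and Re
    U_n; 87 is 128 * 169/250 rounded up. The bound 13 a^2 y^2 is what [step_bound] tolerates. *)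
Lemma pade_ratio_bounds a y e H : 3 / 4 <= a -> 10 ^+ 6 * a ^+ 2 <= y ->
  e = 87 * a / y -> H = 128 * a * (y + 1) ->
  [/\ 0 < e, e <= 1 / 2, 1 <= H, e ^+ 3 * H <= 1 &
      H <= 13 * a ^+ 2 * y ^+ 2 /\ H ^+ 3 * e ^+ 3 <= 13 * a ^+ 2 * y ^+ 2].
Proof.
move=> a34 ya eE HE.
have a2 : 9 / 16 <= a ^+ 2 by nra.
have aa2 : a * (3 / 4) <= a ^+ 2 by nra.
have y1 : 10 ^+ 5 <= y by lra.
have y0 : 0 < y by lra.
have ye : e * y = 87 * a by rewrite eE mulfVK // gt_eqF.
have e0 : 0 < e by rewrite eE divr_gt0 //; nra.
have e1 : e <= 1 / 2 by rewrite eE ler_pdivrMr //; lra.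
have H1 : 1 <= H by rewrite HE; nra.
have yy : (10 ^+ 6) ^+ 2 * a ^+ 4 <= y ^+ 2.
  rewrite (_ : _ * _ = (10 ^+ 6 * a ^+ 2) ^+ 2); last by ring.
  by rewrite lerXn2r ?nnegrE //; [rewrite mulr_ge0 ?sqr_ge0 // exprn_ge0 | exact: ltW].
have a4 : 0 <= a ^+ 4 by rewrite exprn_ge0 //; lra.
have y20 : 0 < y ^+ 2 by rewrite exprn_gt0.
have y30 : 0 < y ^+ 3 by rewrite exprn_gt0.
have E3 : e ^+ 3 * y ^+ 3 = 87 ^+ 3 * a ^+ 3 by rewrite -!exprMn ye.
have Hle : H <= 129 * a * y.
  have h : a * 10 ^+ 5 <= a * y by apply: ler_wpM2l => //; lra.
  by rewrite HE; lra.
have eH : e ^+ 3 * H * y ^+ 2 <= 10 ^+ 8 * a ^+ 4.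
  rewrite -(ler_pM2r y0).
  have -> : e ^+ 3 * H * y ^+ 2 * y = 87 ^+ 3 * a ^+ 3 * H.
    by rewrite -E3; ring.
  have : 87 ^+ 3 * a ^+ 3 * H <= 87 ^+ 3 * a ^+ 3 * (129 * a * y).
    by apply: ler_wpM2l => //; rewrite mulr_ge0 ?exprn_ge0 //; lra.
  have -> : 87 ^+ 3 * a ^+ 3 * (129 * a * y) = 87 ^+ 3 * 129 * (a ^+ 4 * y) by ring.
  have : 0 <= a ^+ 4 * y by rewrite mulr_ge0 // ltW.
  by lra.
have eH0 : 0 <= e ^+ 3 * H by rewrite mulr_ge0 ?exprn_ge0 //; lra.
split=> //; first by rewrite -(ler_pM2r y20) mul1r; lra.
split.
  apply: (le_trans Hle); rewrite (_ : 13 * _ * _ = (13 * a * y) * (a * y)); last by ring.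
  rewrite (_ : 129 * a * y = (a * y) * 129); last by ring.
  rewrite (_ : 13 * a * y * (a * y) = (a * y) * (13 * (a * y))); last by ring.
  have ay : 10 <= a * y by nra.
  by apply: ler_wpM2l; lra.
have -> : H ^+ 3 * e ^+ 3 = H ^+ 2 * (e ^+ 3 * H) by ring.
rewrite -(ler_pM2r y20).
have H2 : H ^+ 2 <= (129 * a * y) ^+ 2.
  by rewrite lerXn2r ?nnegrE //; [lra | rewrite !mulr_ge0 //; lra].
have T1 : H ^+ 2 * (e ^+ 3 * H) * y ^+ 2 <= (129 * a * y) ^+ 2 * (10 ^+ 8 * a ^+ 4).
  by rewrite -mulrA; apply: ler_pM => //; [exact: sqr_ge0 | rewrite mulr_ge0 // ltW].
apply: (le_trans T1).
rewrite (_ : (129 * a * y) ^+ 2 * _ = a ^+ 2 * y ^+ 2 * (129 ^+ 2 * 10 ^+ 8 * a ^+ 4)); last by ring.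
rewrite (_ : 13 * a ^+ 2 * y ^+ 2 * y ^+ 2 = a ^+ 2 * y ^+ 2 * (13 * y ^+ 2)); last by ring.
apply: ler_wpM2l; first by rewrite mulr_ge0 // sqr_ge0.
by lra.
Qed.

(** The cube of the hypothesis on [er] bounds the last term by V / 2, since 13/50 * 13 <= (19/10)^3
    / 2. The other term is then at least V / 2, and 25/13 >= 19/10 gives back the same bound with
    [es]. *)
Lemma step_bound (u u' V er es Hs : R) :
  0 < u -> 0 < u' -> 0 < V -> 0 < er -> 0 <= es ->
  19 / 10 * V * u ^+ 3 <= u' * er ->
  Hs * er ^+ 3 <= 13 * V ^+ 4 * (u ^+ 4) ^+ 2 ->
  V <= u' * (13 / 50 / u ^+ 3) * es + 13 / 50 / u' ^+ 3 * u * Hs ->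
  19 / 10 * V * u ^+ 3 <= u' * es.
Proof.
move=> u0 u'0 V0 er0 es0 Pr HH VV.
have u30 : 0 < u ^+ 3 by rewrite exprn_gt0.
have u'30 : 0 < u' ^+ 3 by rewrite exprn_gt0.
have er30 : 0 < er ^+ 3 by rewrite exprn_gt0.
have P3 : (19 / 10 * V * u ^+ 3) ^+ 3 <= (u' * er) ^+ 3.
  by rewrite lerXn2r ?nnegrE // ?mulr_ge0 //; try lra; rewrite ?ltW.
have B1 : 13 / 50 * u * Hs <= V / 2 * u' ^+ 3.
  rewrite -(ler_pM2r er30).
  have -> : V / 2 * u' ^+ 3 * er ^+ 3 = V / 2 * (u' * er) ^+ 3 by ring.
  have : V / 2 * (19 / 10 * V * u ^+ 3) ^+ 3 <= V / 2 * (u' * er) ^+ 3.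
    by apply: ler_wpM2l => //; lra.
  have : 13 / 50 * u * (Hs * er ^+ 3) <= 13 / 50 * u * (13 * V ^+ 4 * (u ^+ 4) ^+ 2).
    by apply: ler_wpM2l => //; lra.
  have -> : 13 / 50 * u * (13 * V ^+ 4 * (u ^+ 4) ^+ 2) = 169 / 50 * (V ^+ 4 * u ^+ 9) by field.
  have -> : V / 2 * (19 / 10 * V * u ^+ 3) ^+ 3 = 6859 / 2000 * (V ^+ 4 * u ^+ 9) by field.
  have : 0 <= V ^+ 4 * u ^+ 9 by rewrite mulr_ge0 ?exprn_ge0 // ltW.
  by lra.
have B2 : 13 / 50 / u' ^+ 3 * u * Hs <= V / 2.
  have -> : 13 / 50 / u' ^+ 3 * u * Hs = 13 / 50 * u * Hs / u' ^+ 3 by field; rewrite gt_eqF.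
  by rewrite ler_pdivrMr.
have B3 : V / 2 <= u' * (13 / 50 / u ^+ 3) * es by lra.
have : V / 2 * u ^+ 3 <= u' * (13 / 50 / u ^+ 3) * es * u ^+ 3 by apply: ler_wpM2r => //; apply: ltW.
have -> : u' * (13 / 50 / u ^+ 3) * es * u ^+ 3 = 13 / 50 * (u' * es) by field; rewrite gt_eqF.
have : 0 < V * u ^+ 3 by rewrite mulr_gt0.
by lra.
Qed.

Lemma N1_bound (u u' w w' q r V : R) : 10 <= u -> 0 < u' -> 0 < V -> 3 / 4 <= V ^+ 2 ->
  1 / 4 <= w * u ^+ 3 -> 4 * u ^+ 2 <= q -> 0 <= w' -> 0 <= r -> r <= u * (u ^+ 4 + 1) ->
  w' * u' ^+ 3 <= 13 / 50 -> 3 * V * u ^+ 3 <= u' ->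
  u' * w ^+ 3 * q = w' * r -> False.
Proof.
move=> u10 u'0 V0 V34 wu qu w'0 r0 rle w'u' gap E.
have u0 : 0 < u by lra.
have u40 : 1 <= u ^+ 4 by rewrite exprn_ege1 //; lra.
have u'30 : 0 < u' ^+ 3 by rewrite exprn_gt0.
have u'40 : 0 < u' ^+ 4 by rewrite exprn_gt0.
have u90 : 0 < u ^+ 9 by rewrite exprn_gt0.
(* Multiplying by u'^3 u^9 replaces w and w' by the products w u^3 and w' u'^3, which are bounded on
   the needed sides. *)
have A1 : u' ^+ 4 * (w * u ^+ 3) ^+ 3 * q = (w' * u' ^+ 3) * r * u ^+ 9.
  have -> : w' * u' ^+ 3 * r * u ^+ 9 = (w' * r) * u' ^+ 3 * u ^+ 9 by ring.
  by rewrite -E; ring.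
have A2 : (w' * u' ^+ 3) * r * u ^+ 9 <= (13 / 50) * (u * (2 * u ^+ 4)) * u ^+ 9.
  apply: ler_wpM2r; first exact: ltW.
  apply: ler_pM => //; first by rewrite mulr_ge0 // ltW.
  by apply: (le_trans rle); apply: ler_wpM2l; [exact: ltW | lra].
have A3 : u' ^+ 4 * (1 / 4) ^+ 3 * (4 * u ^+ 2) <= u' ^+ 4 * (w * u ^+ 3) ^+ 3 * q.
  have h14 : (0 : R) <= 1 / 4 by lra.
  have K : (1 / 4) ^+ 3 <= (w * u ^+ 3) ^+ 3 by rewrite lerXn2r ?nnegrE //; lra.
  apply: ler_pM => //.
  - exact: mulr_ge0 (ltW u'40) (exprn_ge0 3 h14).
  - by rewrite mulr_ge0 // sqr_ge0.
  - exact: ler_wpM2l (ltW u'40) _ _ K.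
have g2 : (3 * V * u ^+ 3) ^+ 4 <= u' ^+ 4.
  rewrite lerXn2r ?nnegrE //; last exact: ltW.
  by rewrite !mulr_ge0 ?exprn_ge0 //; lra.
have V_pow4_ge : 9 / 16 <= V ^+ 4.
  by rewrite (_ : V ^+ 4 = V ^+ 2 * V ^+ 2); [nra | ring].
have u12 : 0 < u ^+ 12 by rewrite exprn_gt0.
have g3 : 45 * u ^+ 12 <= u' ^+ 4.
  apply: le_trans g2; rewrite (_ : (_ * _) ^+ 4 = 3 ^+ 4 * V ^+ 4 * u ^+ 12); last by ring.
  by apply: ler_wpM2r; [exact: ltW | lra].
have u20 : 0 < u ^+ 2 by rewrite exprn_gt0.
have g4 : 45 * u ^+ 12 * u ^+ 2 <= u' ^+ 4 * u ^+ 2 by apply: ler_wpM2r => //; exact: ltW.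
have u14 : 0 < u ^+ 14 by rewrite exprn_gt0.
lra.
Qed.
End NumericBounds.

Section Pade.
Variable R : realType.
Variables u v u' v' V D X F : R.
Hypotheses (u0 : 0 < u) (u'0 : 0 < u') (V0 : 0 < V) (V34 : 3 / 4 <= V ^+ 2).
Hypothesis (HX : X = u ^+ 4 - 6 * u ^+ 2 * v ^+ 2 + v ^+ 4).
Hypothesis (HF : F = 4 * u * v * (u ^+ 2 - v ^+ 2)).
Hypothesis (F1 : `|F| = 1).
Hypothesis (v_small : `|v| * u ^+ 3 <= 13 / 50).
Hypothesis (v'_small : `|v'| * u' ^+ 3 <= 13 / 50).
Hypotheses (D0 : 0 < D) (D_le : D <= 8 * V ^+ 2) (DZ : D ^+ 2 \is a Num.int).
Hypotheses (XZ : 2 * D * X \is a Num.int).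
Hypotheses (dotZ : D * ((u * u' + v * v') / V) \is a Num.int).
Hypotheses (detZ : (u' * v - u * v') / V \is a Num.int).
Hypothesis (u_big : 10 ^+ 6 * V ^+ 4 <= u ^+ 4).
Hypothesis (gap : 3 * V * u ^+ 3 <= u').

Let y := u ^+ 4.
(** With W = u + i v and T = u' + i v', [IS n] and [RS n] are the imaginary and real parts of U_n,
    and [N n] is Im (conj T * U_n). The argument 1 stands for F^2. *)
Let IS n := rec2 (lam R) X 1 v (v * X - u * F / 4) n.
Let RS n := rec2 (lam R) X 1 u (u * X + v * F / 4) n.
Let N n := u' * IS n - v' * RS n.
Let e := 87 * V ^+ 2 / y.
Let H := 128 * V ^+ 2 * (y + 1).

Lemma F_sqr : F ^+ 2 = 1.
Proof. by rewrite -(real_normK (num_real F)) F1 expr1n. Qed.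

Lemma V_pow4_ge : 9 / 16 <= V ^+ 4.
Proof.
rewrite (_ : V ^+ 4 = V ^+ 2 * V ^+ 2); last by ring.
by rewrite (_ : 9 / 16 = 3 / 4 * (3 / 4)); [apply: ler_pM => //; lra | field].
Qed.

Lemma y_ge : 10 ^+ 5 <= y.
Proof.
apply: le_trans u_big; apply: le_trans (ler_wpM2l _ V_pow4_ge); last by rewrite exprn_ge0.
by lra.
Qed.

Lemma y_gt0 : 0 < y.
Proof. by apply: lt_le_trans y_ge; rewrite exprn_gt0. Qed.

Lemma u_ge : 10 <= u.
Proof. exact: (pow4_ge (ltW u0) y_ge). Qed.

Lemma v_le : `|v| <= 1 / 100.
Proof. exact: (small_of_cube (normr_ge0 v) u_ge v_small). Qed.

Lemma vsq_le : v ^+ 2 <= 1 / 100.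
Proof. by rewrite -(real_normK (num_real v)); apply: sqr_small v_le. Qed.

Lemma uv_sq : 10 * u ^+ 2 * v ^+ 2 <= 169 / 250 / y.
Proof.
rewrite ler_pdivlMr ?y_gt0 //.
have -> : 10 * u ^+ 2 * v ^+ 2 * y = 10 * (`|v| * u ^+ 3) ^+ 2.
  by rewrite exprMn (real_normK (num_real v)) /y; ring.
by apply: sqr_bound v_small; rewrite mulr_ge0 // exprn_ge0 // ltW.
Qed.

Lemma IS_bound n : `|IS n| <= 13 / 50 / u ^+ 3 * (169 / 250 / y) ^+ n.
Proof.
have u30 : 0 < u ^+ 3 by rewrite exprn_gt0.
have vu : `|v| <= u by have := v_le; have := u_ge; lra.
have := rec2_sin_bound n u0 vu HX HF; rewrite F_sqr => /le_trans; apply.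
apply: ler_pM => //.
- by rewrite exprn_ge0 // mulr_ge0 ?sqr_ge0 // mulr_ge0 // sqr_ge0.
- by rewrite ler_pdivlMr.
apply: lerXn2r; rewrite ?nnegrE ?uv_sq //.
- by rewrite mulr_ge0 ?sqr_ge0 // mulr_ge0 // sqr_ge0.
- by rewrite divr_ge0 // ?ltW ?y_gt0 //; lra.
Qed.

Lemma X_norm : `|X| <= y.
Proof.
have -> : X = u ^+ 2 * u ^+ 2 - 6 * (u ^+ 2 * v ^+ 2) + v ^+ 2 * v ^+ 2 by rewrite HX; ring.
have -> : y = u ^+ 2 * u ^+ 2 by rewrite /y; ring.
apply: X_bound (sqr_ge0 v) vsq_le.
rewrite (_ : 100 = 10 * 10); last by ring.
by rewrite expr2; apply: ler_pM; rewrite ?u_ge.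
Qed.

Lemma RS_bound n : `|RS n| <= u * (y + 1) ^+ n.
Proof.
apply: (rec2_growth n (ltW u0) (ltW y_gt0) X_norm).
rewrite (le_trans (ler_normD _ _)) // !normrM F1 normfV (gtr0_norm u0).
rewrite (ger0_norm (_ : 0 <= 4)) // mulr1 mulrDr mulr1.
have := X_norm; have := v_le; have h := u_ge => h1 h2.
have : u * `|X| <= u * y by apply: ler_wpM2l => //; apply: ltW.
by move: (u * _) (u * _) => p q; lra.
Qed.

Lemma N_rec n : N n = rec2 (lam R) X 1 (u' * v - u * v')
  ((u' * v - u * v') * X - (u * u' + v * v') * F / 4) n.
Proof.
have -> : N n = u' * IS n + (- v') * RS n by rewrite /N; ring.
rewrite -rec2_lin; congr (rec2 _ _ _ _ _ _); ring.
Qed.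

(** The number N_n / V has denominator dividing (4 D)^n C(2n, n). With D <= 8 V^2 and C(2n, n) <=
    4^n, this is at most (4 * 8 * 4 V^2)^n. *)
Lemma N_lower n : N n != 0 -> V <= (128 * V ^+ 2) ^+ n * `|N n|.
Proof.
move=> Nn0.
have Vn0 : V != 0 by rewrite gt_eqF.
have FZ : F \is a Num.int.
  by move/eqP: F_sqr; rewrite sqrf_eq1 => /orP[] /eqP ->; rewrite ?rpredN rpred1.
have Fn0 : F != 0 by rewrite -normr_gt0 F1.
have := rec2_int n D0 DZ XZ FZ Fn0 detZ dotZ.
rewrite F_sqr (_ : rec2 _ _ _ _ _ _ = V^-1 * N n + 0 * N n); last first.
  rewrite !N_rec -rec2_lin; congr (rec2 _ _ _ _ _ _); [by rewrite mul0r addr0 mulrC|by field].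
rewrite mul0r addr0 => /norm_intr_ge1.
have D40 : 0 < 4 * D by rewrite mulr_gt0.
have bin0 : 0 < 'C(2 * n, n)%:R :> R by rewrite ltr0n bin_gt0 leq_pmull.
have Q0 : 0 < (4 * D) ^+ n * 'C(2 * n, n)%:R by rewrite mulr_gt0 // exprn_gt0.
have Q1 : (4 * D) ^+ n * 'C(2 * n, n)%:R * (V^-1 * N n) != 0.
  by apply: mulf_neq0; [rewrite gt_eqF | apply: mulf_neq0; rewrite ?invr_eq0].
move=> /(_ Q1); rewrite (normrM (_ * _)) (normrM V^-1) (gtr0_norm Q0) normfV (gtr0_norm V0).
rewrite mulrCA -ler_pdivrMl ?invr_gt0 //.
rewrite invrK mulr1 => /le_trans; apply; apply: ler_wpM2r => //.
have -> : (128 * V ^+ 2) ^+ n = (4 * (8 * V ^+ 2)) ^+ n * 4 ^+ n.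
  by rewrite -exprMn; congr (_ ^+ _); ring.
apply: ler_pM => //; first exact: exprn_ge0 (ltW D40).
  apply: lerXn2r; rewrite ?nnegrE; [exact: ltW | | exact: ler_wpM2l].
  by rewrite mulr_ge0 // mulr_ge0 // sqr_ge0.
by rewrite -natrX ler_nat central_bin_le.
Qed.

Lemma N_upper n :
  (128 * V ^+ 2) ^+ n * `|N n| <=
  u' * (13 / 50 / u ^+ 3) * e ^+ n + 13 / 50 / u' ^+ 3 * u * H ^+ n.
Proof.
have Q0 : 0 <= (128 * V ^+ 2) ^+ n by rewrite exprn_ge0 // mulr_ge0 // sqr_ge0.
have u'30 : 0 < u' ^+ 3 by rewrite exprn_gt0.
have A1 : `|N n| <= u' * (13 / 50 / u ^+ 3 * (169 / 250 / y) ^+ n)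
     + 13 / 50 / u' ^+ 3 * (u * (y + 1) ^+ n).
  rewrite /N (le_trans (ler_normB _ _)) // (normrM u') (normrM v') (gtr0_norm u'0).
  apply: lerD; first by apply: ler_wpM2l; [apply: ltW | apply: IS_bound].
  by apply: ler_pM => //; [rewrite ler_pdivlMr | apply: RS_bound].
apply: (le_trans (ler_wpM2l Q0 A1)); rewrite mulrDr; apply: lerD; last first.
  have -> : H ^+ n = (128 * V ^+ 2) ^+ n * (y + 1) ^+ n by rewrite /H exprMn.
  by rewrite le_eqVlt; apply/orP; left; apply/eqP;
    move: ((128 * V ^+ 2) ^+ n) ((y + 1) ^+ n) (13 / 50 / u' ^+ 3) => *; ring.
have -> : (128 * V ^+ 2) ^+ n * (u' * (13 / 50 / u ^+ 3 * (169 / 250 / y) ^+ n)) =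
  u' * (13 / 50 / u ^+ 3) * (128 * V ^+ 2 * (169 / 250 / y)) ^+ n.
  rewrite [in RHS]exprMn.
  by move: ((128 * V ^+ 2) ^+ n) ((_ / y) ^+ n) (13 / 50 / u ^+ 3) => *; ring.
apply: ler_wpM2l.
  by rewrite mulr_ge0 ?divr_ge0 ?exprn_ge0 // ltW.
have yi0 : 0 < y^-1 by rewrite invr_gt0 y_gt0.
have V20 := sqr_ge0 V.
apply: lerXn2r; rewrite ?nnegrE /e.
- by apply: mulr_ge0; [exact: mulr_ge0 | apply: mulr_ge0; [exact: divr_ge0 | exact: ltW]].
- by apply: mulr_ge0; [exact: mulr_ge0 | exact: ltW].
rewrite mulrA; apply: ler_wpM2r; first exact: ltW.
by rewrite [_ * V ^+ 2 * _]mulrAC; apply: ler_wpM2r => //; lra.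
Qed.

(** This bound is carried from index to index by [P_step]; it cannot hold for all n because e <=
    1/2. *)
Let P n := 19 / 10 * V * u ^+ 3 <= u' * e ^+ n.

Lemma e_H_bounds : [/\ 0 < e, e <= 1 / 2, 1 <= H, e ^+ 3 * H <= 1 &
      H <= 13 * V ^+ 4 * y ^+ 2 /\ H ^+ 3 * e ^+ 3 <= 13 * V ^+ 4 * y ^+ 2].
Proof.
have V4E : V ^+ 4 = (V ^+ 2) ^+ 2 by rewrite -exprM.
rewrite V4E; apply: pade_ratio_bounds => //.
by rewrite -V4E.
Qed.

Lemma P_step r s : P r -> N s != 0 -> H ^+ s * e ^+ (3 * r) <= 13 * V ^+ 4 * y ^+ 2 -> P s.
Proof.
have [e0 _ _ _ _] := e_H_bounds.
move=> Pr /N_lower HN HH; apply: (@step_bound _ u u' V (e ^+ r) (e ^+ s) (H ^+ s)) => //.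
- by rewrite exprn_gt0.
- by rewrite exprn_ge0 // ltW.
- by rewrite -(exprM e r 3) (mulnC r 3).
exact: le_trans HN (N_upper s).
Qed.

(** A bound at index m + 1 thus reaches m + 3, over one vanishing [N]. From index 0 the jump to 2
    would need H^2 <= 13 V^4 y^2, which is false; this is why [N1_neq0] is proved apart. *)
Lemma e_H_pow m : H ^+ (m + 3) * e ^+ (3 * m.+1) <= 13 * V ^+ 4 * y ^+ 2.
Proof.
have [e0 _ H1 eH [_ H3]] := e_H_bounds.
have -> : H ^+ (m + 3) * e ^+ (3 * m.+1) = (e ^+ 3 * H) ^+ m * (H ^+ 3 * e ^+ 3).
  rewrite (exprD H m 3) (exprM e 3 m.+1) (exprS (e ^+ 3) m) (exprMn m (e ^+ 3) H).
  by move: (e ^+ 3 ^+ m) (H ^+ m) (e ^+ 3) (H ^+ 3) => *; ring.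
have H0 : 0 <= H by lra.
have E30 : 0 <= e ^+ 3 by rewrite exprn_ge0 // ltW.
apply: le_trans H3; apply: ler_piMl; first by rewrite mulr_ge0 // exprn_ge0.
by apply: exprn_ile1 => //; rewrite mulr_ge0.
Qed.

Lemma u2_ge : 100 <= u ^+ 2.
Proof.
rewrite (_ : 100 = 10 * 10); last by ring.
by rewrite expr2; apply: ler_pM; rewrite ?u_ge.
Qed.

(* If [T] were parallel to [U_1], comparing slopes would give [u'^4 <= 9 u^12],
   against the gap principle. *)
Lemma N1_neq0 : N 1 != 0.
Proof.
apply/negP => /eqP N10.
have h1 := u2_ge; have h2 := vsq_le; have h3 := sqr_ge0 v.
have I1 : IS 1 = - (v ^+ 3 * (5 * u ^+ 2 - v ^+ 2)) by rewrite /IS /rec2 HX HF; field.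
have q0 : 0 <= 5 * u ^+ 2 - v ^+ 2 by lra.
have E : u' * `|v| ^+ 3 * (5 * u ^+ 2 - v ^+ 2) = `|v'| * `|RS 1|.
  rewrite -normrM; move: N10; rewrite /N I1 => /eqP; rewrite subr_eq0 => /eqP <-.
  by rewrite mulrN normrN (normrM u') (normrM (v ^+ 3)) normrX (gtr0_norm u'0) mulrA (ger0_norm q0).
have vlow : 1 / 4 <= `|v| * u ^+ 3.
  have : `|F| = 4 * u * `|v| * (u ^+ 2 - v ^+ 2).
    rewrite HF !normrM (gtr0_norm u0) ger0_norm // (ger0_norm (_ : 0 <= u ^+ 2 - v ^+ 2)) //.
    by lra.
  rewrite F1 (_ : 4 * u * `|v| * (u ^+ 2 - v ^+ 2) = 4 * (`|v| * u ^+ 3) - 4 * (u * `|v| * v ^+ 2));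
    last by ring.
  have := mulr_ge0 (mulr_ge0 (ltW u0) (normr_ge0 v)) h3.
  by move: (_ * v ^+ 2) (`|v| * _) => p q; lra.
have RS1 := RS_bound 1; rewrite expr1 in RS1.
apply: (N1_bound u_ge u'0 V0 V34 vlow _ (normr_ge0 v') (normr_ge0 (RS 1)) RS1 v'_small gap E).
by lra.
Qed.

Lemma pade_contradiction : False.
Proof.
have [e0 e1 H1 eH [Hb _]] := e_H_bounds.
have P0 : P 0.
  rewrite /P expr0 mulr1; apply: le_trans gap.
  have := mulr_gt0 V0 (exprn_gt0 3 u0); rewrite -![_ * V * _]mulrA.
  by move: (V * _) => p; lra.
have P1 : P 1.
  by apply: (P_step P0 N1_neq0); rewrite muln0 expr0 mulr1 expr1.
have PS n : P n.+1.
  elim: n => [//|m IHm].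
  have [N0|N0] := eqVneq (N m.+2) 0; last first.
    apply: (P_step IHm N0); apply: le_trans (e_H_pow m); apply: ler_wpM2r.
      by rewrite exprn_ge0 // ltW.
    by apply: ler_weXn2l => //; rewrite addn3.
  have N1 : N m.+3 != 0.
    have W0 : v * (u * X + v * F / 4) - (v * X - u * F / 4) * u != 0.
      rewrite (_ : _ - _ = F * (u ^+ 2 + v ^+ 2) / 4); last by field.
      rewrite mulf_neq0 ?invr_eq0 ?pnatr_eq0 // mulf_neq0 //; first by rewrite -normr_gt0 F1.
      by rewrite gt_eqF // ltr_wpDr ?sqr_ge0 // exprn_gt0.
    (* If [N m.+2] and [N m.+3] both vanished, two consecutive pairs (RS, IS) would be proportional
       to (u', v') and the Casoratian would be 0. *)
    have := casoratian_neq0 X m.+2 (oner_neq0 R) W0; rewrite -/(IS _) -/(IS _) -/(RS _) -/(RS _).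
    apply: contra_neq => N1; apply: (mulfI (lt0r_neq0 u'0)).
    move: N0 N1; rewrite /N mulr0 => /eqP; rewrite subr_eq0 => /eqP N0 /eqP.
    rewrite subr_eq0 => /eqP N1.
    by rewrite mulrBr !mulrA N0 N1; ring.
  have P3 : P m.+3 by apply: (P_step IHm N1); rewrite -(addn3 m) e_H_pow.
  rewrite /P; apply: (le_trans P3); apply: ler_wpM2l; first exact: ltW.
  by rewrite exprS ler_piMl ?exprn_ge0 //; lra.
pose c := 19 / 10 * V * u ^+ 3.
have c0 : 0 < c by rewrite /c !mulr_gt0 ?exprn_gt0 //; lra.
(* An index exceeding u' / c is enough, since e <= 1/2 and 2^(n+1) > n. *)
have /archi_boundP := ltW (divr_gt0 u'0 c0); set b := Num.bound _.
rewrite ltr_pdivrMr // => ub.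
have := PS b; rewrite /P -/c leNgt => /negP; apply.
have e2 : e ^+ b.+1 <= (1 / 2) ^+ b.+1 by rewrite lerXn2r ?nnegrE //; [exact: ltW | lra].
apply: le_lt_trans (ler_wpM2l (ltW u'0) e2) _.
have b2 : b%:R <= 2 ^+ b.+1 :> R.
  by rewrite -natrX ler_nat ltnW // (ltn_trans (ltn_expl b (isT : (1 < 2)%N))) // ltn_exp2l.
have p2 : 0 < 2 ^+ b.+1 :> R by rewrite exprn_gt0.
rewrite expr_div_n expr1n mul1r ltr_pdivrMr //; apply: lt_le_trans ub _.
by rewrite mulrC; apply: ler_wpM2l => //; exact: ltW.
Qed.
End Pade.

(** * Gaps between solutions *)

Section Sector.
Variable R : realFieldType.
Implicit Types u w V a b : R.

Lemma sqr_ge34 V : 0 < V -> 3 / 4 <= V ^+ 2 -> 433 / 500 <= V.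
Proof. by move=> *; nra. Qed.

(** The constant 4143/10^4 is tan(pi/8) = sqrt 2 - 1 rounded up, and 1717/10^4 bounds its square. *)
Lemma sector_slope u w : 0 < u -> 0 <= w -> w ^+ 2 + 2 * u * w <= u ^+ 2 ->
  w ^+ 2 <= 1717 / 10 ^+ 4 * u ^+ 2.
Proof.
move=> u0 w0 h.
have wu : w <= 4143 / 10 ^+ 4 * u.
  rewrite leNgt; apply/negP => lt.
  have : (4143 / 10 ^+ 4 * u) * (4143 / 10 ^+ 4 * u) <= w * w.
    by apply: ler_pM; nra.
  by nra.
have : w * w <= (4143 / 10 ^+ 4 * u) * (4143 / 10 ^+ 4 * u) by apply: ler_pM.
by nra.
Qed.

(** This is |Z|^4 >= Im Z^4, the difference being the square of Re Z^2 - Im Z^2. *)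
Lemma sector_norm u w : 0 < u -> 0 <= w -> 4 * u * w * (u ^+ 2 - w ^+ 2) = 1 ->
  1 <= u ^+ 2 + w ^+ 2.
Proof.
move=> u0 w0 E.
have h : 1 <= (u ^+ 2 + w ^+ 2) ^+ 2.
  rewrite (_ : _ ^+ 2 = 4 * u * w * (u ^+ 2 - w ^+ 2) + (u ^+ 2 - w ^+ 2 - 2 * u * w) ^+ 2);
    last by ring.
  by rewrite E lerDl sqr_ge0.
by rewrite -(@expr_ge1 _ 2) // addr_ge0 ?sqr_ge0.
Qed.

(** From the slope bound, u^2 >= 1 / 1.1717 and w u^3 <= 1 / (4 * 0.8283). *)
Lemma sector_bounds u w : 0 < u -> 0 <= w -> w ^+ 2 + 2 * u * w <= u ^+ 2 ->
  4 * u * w * (u ^+ 2 - w ^+ 2) = 1 ->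
  853 / 1000 <= u ^+ 2 /\ w * u ^+ 3 <= 151 / 500.
Proof.
move=> u0 w0 h E.
have h1 := sector_slope u0 w0 h; have h2 := sector_norm u0 w0 E.
split; first lra.
have : 4 * u * w * (8283 / 10 ^+ 4 * u ^+ 2) <= 1.
  by rewrite -[leRHS]E; apply: ler_wpM2l; [rewrite !mulr_ge0 // ltW | lra].
by rewrite (_ : 4 * u * w * _ = 4 * (8283 / 10 ^+ 4) * (w * u ^+ 3)); [lra | ring].
Qed.

Lemma sector_bounds2 u w : 2 <= u -> 0 <= w -> w * u ^+ 3 <= 151 / 500 ->
  4 * u * w * (u ^+ 2 - w ^+ 2) = 1 -> w * u ^+ 3 <= 13 / 50.
Proof.
move=> u2 w0 wu E.
have u3 : 8 <= u ^+ 3 by rewrite (_ : u ^+ 3 = u * u * u); [nra | ring].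
have w1 : w <= 1 / 20 by move: (u ^+ 3) wu u3 => c; nra.
have ww : w ^+ 2 <= 1 / 100 * u ^+ 2 by nra.
have u20 := sqr_ge0 u.
have : 4 * u * w * (99 / 100 * u ^+ 2) <= 1.
  rewrite -[leRHS]E; apply: ler_wpM2l; [rewrite !mulr_ge0 //; lra | lra].
by rewrite (_ : 4 * u * w * _ = 4 * (99 / 100) * (w * u ^+ 3)); [lra | ring].
Qed.

(** Here a = u' / u^3 and b = 1 / u^2. A lower bound for a gives b^4 <= c a^3, hence V <= 151/500 (a
    + c), which improves the lower bound for a. This is iterated with c = b, 2/5, 14/100; the
    ordering u <= u', in the form b <= a, starts it. *)
Lemma gap_num V a b : 433 / 500 <= V -> 0 < b -> b <= 1000 / 853 -> b <= a ->
  V * a ^+ 3 <= 151 / 500 * (a ^+ 4 + b ^+ 4) -> 31 / 10 * V <= a.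
Proof.
move=> V1 b0 b1 ba E.
have a0 : 0 < a by lra.
have a30 : 0 < a ^+ 3 by rewrite exprn_gt0.
have step c : b ^+ 4 <= c * a ^+ 3 -> V <= 151 / 500 * (a + c).
  move=> hc; rewrite -(ler_pM2r a30); apply: (le_trans E).
  by rewrite (_ : _ * (a + c) * _ = 151 / 500 * (a ^+ 4 + c * a ^+ 3)); [lra | ring].
have b3a : b ^+ 3 <= a ^+ 3 by rewrite lerXn2r ?nnegrE // ltW.
have A1 : V <= 151 / 500 * (a + b).
  by apply: step; rewrite exprS; apply: ler_wpM2l => //; exact: ltW.
have A2 : 169 / 100 <= a by lra.
have b4 : b ^+ 4 <= 19 / 10.
  have : b ^+ 4 <= (1000 / 853) ^+ 4 by rewrite lerXn2r ?nnegrE //; lra.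
  by lra.
have A3 : V <= 151 / 500 * (a + 2 / 5).
  have h : (169 / 100) ^+ 3 <= a ^+ 3 by rewrite lerXn2r ?nnegrE //; lra.
  by apply: step; lra.
have A4 : 24 / 10 <= a by lra.
have A5 : V <= 151 / 500 * (a + 14 / 100).
  have h : (24 / 10) ^+ 3 <= a ^+ 3 by rewrite lerXn2r ?nnegrE //; lra.
  by apply: step; lra.
lra.
Qed.

Lemma gap1 V u w u' w' : 0 < V -> 3 / 4 <= V ^+ 2 -> 0 < u -> u <= u' -> 0 <= w -> 0 <= w' ->
  853 / 1000 <= u ^+ 2 -> w * u ^+ 3 <= 151 / 500 -> w' * u' ^+ 3 <= 151 / 500 ->
  V <= u * w' + u' * w -> 31 / 10 * V * u ^+ 3 <= u'.
Proof.
move=> V0 V34 u0 uu' w0 w'0 u2 wu w'u' VV.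
have u'0 : 0 < u' by lra.
have un0 : u != 0 by rewrite gt_eqF.
have u30 : 0 < u ^+ 3 by rewrite exprn_gt0.
have u20 : 0 < u ^+ 2 by rewrite exprn_gt0.
have u'30 : 0 < u' ^+ 3 by rewrite exprn_gt0.
rewrite -ler_pdivlMr //.
apply: (@gap_num _ _ (1 / u ^+ 2)); first exact: sqr_ge34.
- by rewrite divr_gt0.
- by rewrite ler_pdivrMr //; lra.
- by rewrite ler_pdivlMr // (_ : 1 / u ^+ 2 * u ^+ 3 = u) //; field.
have u90 : 0 < u ^+ 9 by rewrite exprn_gt0.
rewrite -(ler_pM2r u90).
have -> : V * (u' / u ^+ 3) ^+ 3 * u ^+ 9 = V * u' ^+ 3 by field.
have -> : 151 / 500 * ((u' / u ^+ 3) ^+ 4 + (1 / u ^+ 2) ^+ 4) * u ^+ 9 =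
   151 / 500 * (u' ^+ 4 / u ^+ 3 + u) by field.
have : V * u' ^+ 3 <= (u * w' + u' * w) * u' ^+ 3 by apply: ler_wpM2r => //; exact: ltW.
have : w <= 151 / 500 / u ^+ 3 by rewrite ler_pdivlMr.
move/(ler_wpM2l (exprn_ge0 4 (ltW u'0))).
have := ler_wpM2l (ltW u0) w'u'.
rewrite [u' ^+ 4 * (_ / _)]mulrA [u' ^+ 4 * (151 / 500)]mulrC -[_ * u' ^+ 4 / _]mulrA.
by move: (u' ^+ 4 / u ^+ 3) => p; lra.
Qed.

(** For u >= 2 the product u w' is at most 13/200, so u' w accounts for at least 92/100 of V, and
    0.92 / 0.26 exceeds 7/2. *)
Lemma gap2 V u w u' w' : 0 < V -> 3 / 4 <= V ^+ 2 -> 2 <= u -> u <= u' -> 0 <= w -> 0 <= w' ->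
  w * u ^+ 3 <= 13 / 50 -> w' * u' ^+ 3 <= 13 / 50 ->
  V <= u * w' + u' * w -> 7 / 2 * V * u ^+ 3 <= u'.
Proof.
move=> V0 V34 u2 uu' w0 w'0 wu w'u' VV.
have V1 := sqr_ge34 V0 V34.
have u0 : 0 < u by lra.
have u30 : 0 < u ^+ 3 by rewrite exprn_gt0.
have uw' : u * w' <= 13 / 200.
  have h : u * w' * 4 <= w' * u' ^+ 3.
    have uu3 : u * 4 <= u' ^+ 3.
      by rewrite (_ : u' ^+ 3 = u' * (u' * u')); [apply: ler_pM => //; nra | ring].
    by rewrite [u * w']mulrC -mulrA; apply: ler_wpM2l.
  by lra.
have h1 : 4 / 5 <= V - 13 / 200 by lra.
have h2 : V * (184 / 200) <= u' * w by lra.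
have : V * (184 / 200) * u ^+ 3 <= u' * w * u ^+ 3 by apply: ler_wpM2r => //; exact: ltW.
have : u' * (w * u ^+ 3) <= u' * (13 / 50) by apply: ler_wpM2l => //; lra.
have := mulr_gt0 V0 u30.
by lra.
Qed.

Lemma second_large V u1 u2 : 0 < V -> 0 < u1 -> 853 / 1000 <= u1 ^+ 2 ->
  31 / 10 * V * u1 ^+ 3 <= u2 -> 243 / 100 * V <= u2.
Proof.
move=> V0 u10 u1sq g1.
have u130 : 0 < u1 ^+ 3 by rewrite exprn_gt0.
have c1 : 787 / 1000 <= u1 ^+ 3.
  rewrite -ler_sqr ?nnegrE; [|lra|exact: ltW].
  have -> : (u1 ^+ 3) ^+ 2 = (u1 ^+ 2) ^+ 3 by ring.
  have : (853 / 1000) ^+ 3 <= (u1 ^+ 2) ^+ 3 by rewrite lerXn2r ?nnegrE ?sqr_ge0 //; lra.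
  by apply: le_trans; lra.
apply: le_trans g1; have : V * (787 / 1000) <= V * u1 ^+ 3 by apply: ler_wpM2l => //; exact: ltW.
by lra.
Qed.

Lemma second_ge V u1 u2 : 0 < V -> 3 / 4 <= V ^+ 2 -> 0 < u1 -> 853 / 1000 <= u1 ^+ 2 ->
  31 / 10 * V * u1 ^+ 3 <= u2 -> 2 <= u2.
Proof.
move=> V0 V34 u10 u1sq g1.
by have := sqr_ge34 V0 V34; have := second_large V0 u10 u1sq g1; lra.
Qed.

(** The two gaps give u3 >= 50 V^4, and 50^4 (3/4)^6 exceeds 10^6: the third solution is the first
    one known to be large enough for the Pade argument. *)
Lemma third_large V u1 u2 u3 : 0 < V -> 3 / 4 <= V ^+ 2 -> 0 < u1 -> 853 / 1000 <= u1 ^+ 2 ->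
  31 / 10 * V * u1 ^+ 3 <= u2 -> 7 / 2 * V * u2 ^+ 3 <= u3 ->
  10 ^+ 6 * V ^+ 4 <= u3 ^+ 4.
Proof.
move=> V0 V34 u10 u1sq g1 g2.
have c2 := second_large V0 u10 u1sq g1.
have c3 : (243 / 100 * V) ^+ 3 <= u2 ^+ 3 by rewrite lerXn2r ?nnegrE //; lra.
have V40 : 0 < V ^+ 4 by rewrite exprn_gt0.
have c4 : 50 * V ^+ 4 <= u3.
  apply: le_trans g2; have : V * (243 / 100 * V) ^+ 3 <= V * u2 ^+ 3.
    by apply: ler_wpM2l => //; exact: ltW.
  rewrite (_ : V * (243 / 100 * V) ^+ 3 = (243 / 100) ^+ 3 * V ^+ 4); last by ring.
  by lra.
have c5 : (50 * V ^+ 4) ^+ 4 <= u3 ^+ 4 by rewrite lerXn2r ?nnegrE //; lra.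
apply: le_trans c5.
have V12 : (3 / 4) ^+ 6 <= (V ^+ 2) ^+ 6 by rewrite lerXn2r ?nnegrE ?sqr_ge0 //; lra.
rewrite (_ : (50 * V ^+ 4) ^+ 4 = 50 ^+ 4 * (V ^+ 2) ^+ 6 * V ^+ 4); last by ring.
by apply: ler_wpM2r; [exact: ltW | lra].
Qed.
End Sector.

(** * Solutions near one line *)

Definition lin (R : realType) (a b : R) (p : int * int) : R := a * p.1%:~R + b * p.2%:~R.

(* [|v| <= (sqrt 2 - 1) |u|]: the 45-degree double sector around [v = 0]. *)
Definition in_sector (R : realType) (u v : R) := `|v| ^+ 2 + 2 * `|u| * `|v| <= u ^+ 2.

Section SectorCount.
Variable R : realType.
Variables u1 u2 v1 v2 D V : R.
Local Notation U := (lin u1 u2).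
Local Notation W := (lin v1 v2).
Hypothesis VE : V = `|u1 * v2 - u2 * v1|.
Hypotheses (V0 : 0 < V) (V34 : 3 / 4 <= V ^+ 2).
Hypotheses (D0 : 0 < D) (D_le : D <= 8 * V ^+ 2) (DZ : D ^+ 2 \is a Num.int).
Hypothesis XZ : forall p, 2 * D * (U p ^+ 4 - 6 * U p ^+ 2 * W p ^+ 2 + W p ^+ 4) \is a Num.int.
Hypothesis dotZ : forall p q, D * ((U p * U q + W p * W q) / V) \is a Num.int.

Definition sector_sol p := [/\ `|4 * U p * W p * (U p ^+ 2 - W p ^+ 2)| = 1, 0 < U p &
  in_sector (U p) (W p)].

Lemma lin_det p q : U p * W q - U q * W p =
  (u1 * v2 - u2 * v1) * (p.1 * q.2 - p.2 * q.1)%:~R.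
Proof. by rewrite /lin !rmorphB !rmorphM /=; ring. Qed.

Lemma detZ p q : (U q * W p - U p * W q) / V \is a Num.int.
Proof.
have Vn0 : V != 0 by rewrite gt_eqF.
rewrite lin_det; case: (lerP 0 (u1 * v2 - u2 * v1)) => h; rewrite VE in Vn0 *.
  by rewrite ger0_norm // in Vn0 *; rewrite mulrAC mulfV // mul1r intr_int.
rewrite ltr0_norm // in Vn0 *.
by rewrite mulrAC invrN mulrN mulfV ?mulN1r ?rpredN ?intr_int // -oppr_eq0.
Qed.

Lemma lin_inj p q : U p = U q -> W p = W q -> p = q.
Proof.
have dn0 : u1 * v2 - u2 * v1 != 0 by rewrite -normr_gt0 -VE.
move=> eU eW; case: p q eU eW => [a b] [c d]; rewrite /lin /= => eU eW.
have E1 : (u1 * v2 - u2 * v1) * a%:~R = (u1 * v2 - u2 * v1) * c%:~R.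
  transitivity (v2 * (u1 * a%:~R + u2 * b%:~R) - u2 * (v1 * a%:~R + v2 * b%:~R)); first by ring.
  by rewrite eU eW; ring.
have E2 : (u1 * v2 - u2 * v1) * b%:~R = (u1 * v2 - u2 * v1) * d%:~R.
  transitivity (u1 * (v1 * a%:~R + v2 * b%:~R) - v1 * (u1 * a%:~R + u2 * b%:~R)); first by ring.
  by rewrite eU eW; ring.
by congr (_, _); apply/eqP; rewrite -(eqr_int R); apply/eqP; apply: (mulfI dn0).
Qed.

(** The determinant is V times an integer. If that integer were 0, q would be t p with t > 0, and
    |F| = 1 at both points would force t^4 = 1. *)
Lemma sol_det p q : sector_sol p -> sector_sol q -> p <> q -> V <= U p * `|W q| + U q * `|W p|.
Proof.
move=> [Fp Up _] [Fq Uq _] pq.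
have tri : `|U p * W q - U q * W p| <= U p * `|W q| + U q * `|W p|.
  by rewrite (le_trans (ler_normB _ _)) // !normrM (gtr0_norm Up) (gtr0_norm Uq).
apply: le_trans tri; rewrite lin_det normrM -VE ler_peMr ?(ltW V0) //.
apply: norm_intr_ge1; first exact: intr_int.
rewrite intr_eq0; apply/negP => /eqP m0; apply: pq.
have det0 : U p * W q = U q * W p.
  by apply/eqP; rewrite -subr_eq0 lin_det m0 mulr0.
have Upn0 : U p != 0 by rewrite gt_eqF.
pose t := U q / U p.
have t0 : 0 < t by rewrite divr_gt0.
have Uqt : U q = t * U p by rewrite mulfVK.
have Wqt : W q = t * W p by rewrite /t mulrAC -det0 mulrAC mulfV // mul1r.
have t1 : t = 1.
  move: Fq; rewrite Uqt Wqt.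
  rewrite (_ : 4 * _ * _ * _ = t ^+ 4 * (4 * U p * W p * (U p ^+ 2 - W p ^+ 2))); last by ring.
  rewrite normrM Fp mulr1 (ger0_norm (exprn_ge0 4 (ltW t0))) => /eqP.
  by rewrite (pexpr_eq1 _ (ltW t0)) // => /eqP.
by apply: lin_inj; rewrite ?Uqt ?Wqt t1 mul1r.
Qed.

Lemma sol_unsigned p : sector_sol p -> 4 * U p * `|W p| * (U p ^+ 2 - `|W p| ^+ 2) = 1
  /\ `|W p| ^+ 2 + 2 * U p * `|W p| <= U p ^+ 2.
Proof.
move=> [Fp Up]; rewrite /in_sector (gtr0_norm Up) => sec; split=> //.
rewrite -[RHS]Fp !normrM (gtr0_norm Up) (ger0_norm (_ : 0 <= 4)) // real_normK ?num_real //.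
rewrite (ger0_norm (_ : 0 <= U p ^+ 2 - W p ^+ 2)) // subr_ge0.
by rewrite -(real_normK (num_real (W p))) (le_trans _ sec) // lerDl !mulr_ge0 // ltW.
Qed.

Lemma no_four q1 q2 q3 q4 : sector_sol q1 -> sector_sol q2 -> sector_sol q3 -> sector_sol q4 ->
  q1 <> q2 -> q2 <> q3 -> q3 <> q4 -> U q1 <= U q2 -> U q2 <= U q3 -> U q3 <= U q4 -> False.
Proof.
move=> s1 s2 s3 s4 n12 n23 n34 le12 le23 le34.
have := sol_det s1 s2 n12; have := sol_det s2 s3 n23; have := sol_det s3 s4 n34.
have [E1 S1] := sol_unsigned s1; have [E2 S2] := sol_unsigned s2.
have [E3 S3] := sol_unsigned s3; have [E4 S4] := sol_unsigned s4.
have [_ p1 _] := s1; have [_ p2 _] := s2; have [F3 p3 _] := s3; have [_ p4 _] := s4.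
have [a1 b1] := sector_bounds p1 (normr_ge0 _) S1 E1.
have [_ b2] := sector_bounds p2 (normr_ge0 _) S2 E2.
have [_ b3] := sector_bounds p3 (normr_ge0 _) S3 E3.
have [_ b4] := sector_bounds p4 (normr_ge0 _) S4 E4 => d34 d23 d12.
have g1 := gap1 V0 V34 p1 le12 (normr_ge0 _) (normr_ge0 _) a1 b1 b2 d12.
have u2_2 : 2 <= U q2 by exact: second_ge V0 V34 p1 a1 g1.
have c2 := sector_bounds2 u2_2 (normr_ge0 _) b2 E2.
have c3 := sector_bounds2 (le_trans u2_2 le23) (normr_ge0 _) b3 E3.
have c4 := sector_bounds2 (le_trans u2_2 (le_trans le23 le34)) (normr_ge0 _) b4 E4.
have g2 := gap2 V0 V34 u2_2 le23 (normr_ge0 _) (normr_ge0 _) c2 c3 d23.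
have g3 := gap2 V0 V34 (le_trans u2_2 le23) le34 (normr_ge0 _) (normr_ge0 _) c3 c4 d34.
have y3 := third_large V0 V34 p1 a1 g1 g2.
apply: (pade_contradiction p3 p4 V0 V34 erefl erefl F3 c3 c4 D0 D_le DZ (XZ q3)
  (dotZ q3 q4) (detZ q3 q4) y3).
apply: le_trans g3; apply: ler_wpM2r; first by rewrite exprn_ge0 // ltW.
by apply: ler_wpM2r; [exact: ltW | lra].
Qed.

(** No bound on the solutions is available from which to list them, so the argument is by
    contradiction: if no list of three suffices, four distinct solutions can be picked, and sorting
    them by [U] contradicts [no_four]. *)
Lemma sol_cover : exists s : seq (int * int), (size s <= 3)%N /\ forall p, sector_sol p -> p \in s.
Proof.
apply: contrapT => nocov.
have ext s : (size s <= 3)%N -> exists p, sector_sol p /\ p \notin s.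
  move=> ss; apply: contrapT => H; apply: nocov; exists s; split=> // p solp.
  by apply/negPn/negP => ps; apply: H; exists p.
have [p1 [s1 _]] := ext [::] isT.
have [p2 [s2 n2]] := ext [:: p1] isT.
have [p3 [s3 n3]] := ext [:: p2; p1] isT.
have [p4 [s4 n4]] := ext [:: p3; p2; p1] isT.
pose r := [:: p4; p3; p2; p1].
have ur : uniq r by rewrite /= n4 n3 n2.
have sr p : p \in r -> sector_sol p.
  by rewrite !inE => /orP[/eqP->|/orP[/eqP->|/orP[/eqP->|/eqP->]]].
pose leU := [rel p q | U p <= U q].
have tot : total leU by move=> p q; rewrite /= le_total.
have := sort_sorted tot r; have := sort_uniq leU r; rewrite ur.
have := mem_sort leU r; have := size_sort leU r.
case: (sort leU r) => [|a [|b [|c [|d [|]]]]] //= _ mem /and4P[na nb nc _] /and4P[ab bc cd _].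
have so p : p \in [:: a; b; c; d] -> sector_sol p by rewrite mem => /sr.
apply: (no_four _ _ _ _ _ _ _ ab bc cd).
- by apply: so; rewrite !inE eqxx.
- by apply: so; rewrite !inE eqxx orbT.
- by apply: so; rewrite !inE eqxx !orbT.
- by apply: so; rewrite !inE eqxx !orbT.
- by move=> e; rewrite e !inE eqxx in na.
- by move=> e; rewrite e !inE eqxx in nb.
- by move=> e; rewrite e !inE eqxx in nc.
Qed.

Lemma sector_cover : exists s : seq (int * int), (size s <= 3)%N /\
  forall x y : int, let p := (x, y) in
    `|4 * U p * W p * (U p ^+ 2 - W p ^+ 2)| = 1 -> in_sector (U p) (W p) ->
    (x, y) \in s \/ (- x, - y) \in s.
Proof.
have [s [ss cov]] := sol_cover; exists s; split=> // x y p Fp sec.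
have UN : U (- x, - y) = - U p by rewrite /lin /= !rmorphN /=; ring.
have WN : W (- x, - y) = - W p by rewrite /lin /= !rmorphN /=; ring.
case: (ltrgtP 0 (U p)) => Up.
- by left; apply: cov.
- right; apply: cov; split.
  + by rewrite UN WN -[RHS]Fp; congr (`|_|); ring.
  + by rewrite UN oppr_gt0.
  + by move: sec; rewrite /in_sector UN WN !normrN sqrrN.
by move: Fp; rewrite -Up mulr0 !mul0r normr0 => /esym/eqP; rewrite oner_eq0.
Qed.
End SectorCount.

(** * Integral quadratic forms *)

Section IntegralForm.

Lemma hermite (a b c : int) : 0 < a -> 0 < 4 * a * c - b ^+ 2 ->
  exists x y : int, (x, y) != (0, 0) /\
    3 * (a * x ^+ 2 + b * x * y + c * y ^+ 2) ^+ 2 <= 4 * a * c - b ^+ 2.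
Proof.
have [n] := ubnP `|a|%N; elim: n a b c => // n IHn a b c an a0 D0.
(* Gauss reduction: the translation x -> x + k y brings |b| below a. *)
pose k := - ((b + a) %/ (2 * a))%Z.
pose b' := b + 2 * a * k; pose c' := a * k ^+ 2 + b * k + c.
have DE : 4 * a * c' - b' ^+ 2 = 4 * a * c - b ^+ 2 by rewrite /b' /c'; ring.
have a20 : 0 < 2 * a by rewrite mulr_gt0.
have b'E : b' = ((b + a) %% (2 * a))%Z - a.
  have := divz_eq (b + a) (2 * a); rewrite /b' /k; move: (_ %/ _)%Z (_ %% _)%Z => q r E.
  have -> : r = b + a - q * (2 * a) by rewrite E addrAC subrr add0r.
  by ring.
have r0 : 0 <= ((b + a) %% (2 * a))%Z by rewrite modz_ge0 // gt_eqF.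
have r1 := ltz_pmod (b + a) a20.
have bb : 0 <= (a - b') * (a + b').
  rewrite b'E; move: (_ %% _)%Z r0 r1 => r r0 r1.
  by apply: mulr_ge0; clear -r0 r1; lia.
have QE x y : a * (x + k * y) ^+ 2 + b * (x + k * y) * y + c * y ^+ 2
   = a * x ^+ 2 + b' * x * y + c' * y ^+ 2 by rewrite /b' /c'; ring.
rewrite -DE in D0 *; move: b' c' b'E DE bb D0 QE => b' c' _ _ bb D0 QE.
(* If a <= c', then b'^2 <= a^2 <= a c' and the point (1, 0) of the reduced form works. Otherwise
   the outer coefficients are swapped, which lowers the leading one. *)
have [ca|ca] := lerP a c'.
  exists 1, 0; split=> //.
  have := mulr_ge0 (ltW a0) (_ : 0 <= c' - a); rewrite subr_ge0 => /(_ ca) h.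
  rewrite !(expr1n, expr0n, mulr0, mulr1, addr0) /=.
  by clear - bb h; lra.
have c0 : 0 < c'.
  have a40 : 0 < 4 * a by rewrite mulr_gt0.
  rewrite -(pmulr_rgt0 _ a40).
  by have := sqr_ge0 b'; clear - D0; lra.
have D0' : 0 < 4 * c' * a - (- b') ^+ 2 by rewrite sqrrN mulrAC.
have cn : (`|c'| < n)%N by clear - ca c0 an a0; lia.
have [x [y [xy H]]] := IHn c' (- b') a cn c0 D0'.
(* The point found for the swapped form is carried back through the swap (x, y) -> (-y, x) and the
   translation by k. *)
exists (- y + k * x), x; split.
  apply: contraNN xy => /eqP[E1 E2]; move: E1.
  by rewrite E2 mulr0 addr0 => /eqP; rewrite oppr_eq0 => /eqP ->.
rewrite QE (_ : 4 * a * c' - _ = 4 * c' * a - (- b') ^+ 2); last by ring.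
by rewrite (_ : a * _ + _ + _ = c' * x ^+ 2 + - b' * x * y + a * y ^+ 2); last by ring.
Qed.

(** Every product of two of n, n1, n2 is a multiple of n, hence so is the square of their gcd, by
    Bezout. With n, n1, n2 equal to A^2, A B, A C below, it makes (A, B, C) a multiple of an
    integral vector by the square root of an integer. *)
Lemma dvdz_gcd_sqr (n n1 n2 m11 m12 m22 : int) :
  n1 ^+ 2 = n * m11 -> n1 * n2 = n * m12 -> n2 ^+ 2 = n * m22 ->
  exists d g a b c : int, [/\ d ^+ 2 = n * g, n = a * d, n1 = b * d & n2 = c * d].
Proof.
move=> e11 e12 e22; pose d1 := gcdz n n1; pose d := gcdz d1 n2.
have [u1 [v1 E1]] := Bezoutz n n1; have [u [v E]] := Bezoutz d1 n2.
have dd1 : (d %| d1)%Z := dvdz_gcdl _ _.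
have /dvdzP[a Ea] : (d %| n)%Z := dvdz_trans dd1 (dvdz_gcdl _ _).
have /dvdzP[b Eb] : (d %| n1)%Z := dvdz_trans dd1 (dvdz_gcdr _ _).
have /dvdzP[c Ec] : (d %| n2)%Z := dvdz_gcdr _ _.
exists d, ((u * u1) ^+ 2 * n + (u * v1) ^+ 2 * m11 + v ^+ 2 * m22
  + 2 * (u * u1) * (u * v1) * n1 + 2 * (u * u1) * v * n2 + 2 * (u * v1) * v * m12), a, b, c.
split=> //; rewrite /d -E /d1 -E1.
transitivity ((u * u1) ^+ 2 * n ^+ 2 + (u * v1) ^+ 2 * n1 ^+ 2 + v ^+ 2 * n2 ^+ 2
  + 2 * (u * u1) * (u * v1) * n * n1 + 2 * (u * u1) * v * n * n2
  + 2 * (u * v1) * v * (n1 * n2)); first by ring.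
by rewrite e11 e12 e22; ring.
Qed.

Lemma int_of_half (R : realType) (t : R) :
  2 * t \is a Num.int -> t ^+ 2 \is a Num.int -> t \is a Num.int.
Proof.
move=> /intrP[k Ek] /intrP[m Em].
have E : k ^+ 2 = 4 * m.
  apply/eqP; rewrite -(eqr_int R) rmorphXn rmorphM /= -Ek -Em; apply/eqP.
  by rewrite rmorph_nat; ring.
have /dvdzP[j Ej] : (2 %| k)%Z.
  have : (2 %| k ^+ 2)%Z by rewrite E; apply/dvdzP; exists (2 * m); ring.
  by rewrite !dvdzE abszX /= Euclid_dvdX // andbT.
have -> : t = j%:~R.
  apply: (@mulfI _ 2); first by rewrite pnatr_eq0.
  by rewrite Ek Ej intrM [LHS]mulrC.
exact: intr_int.
Qed.
End IntegralForm.

(** * The Hessian covariant *)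

Section Covariants.
Variable R : realType.
Variables (a0 a1 b a3 a4 : int) (u1 u2 v1 v2 V : R).
Local Notation U := (lin u1 u2).
Local Notation W := (lin v1 v2).
Local Notation F x y := (quartic a0 a1 (3 * b) a3 a4 x y).
Hypothesis E0 : a0%:~R = 4 * (u1 ^+ 3 * v1 - u1 * v1 ^+ 3).
Hypothesis E1 : a1%:~R = 4 * (u1 ^+ 3 * v2 + 3 * u1 ^+ 2 * u2 * v1
                              - (v1 ^+ 3 * u2 + 3 * v1 ^+ 2 * v2 * u1)).
Hypothesis E2 : b%:~R = 4 * (u1 ^+ 2 * u2 * v2 + u1 * u2 ^+ 2 * v1
                              - v1 ^+ 2 * v2 * u2 - v1 * v2 ^+ 2 * u1).
Hypothesis E3 : a3%:~R = 4 * (3 * u1 * u2 ^+ 2 * v2 + u2 ^+ 3 * v1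
                              - 3 * v1 * v2 ^+ 2 * u2 - v2 ^+ 3 * u1).
Hypothesis E4 : a4%:~R = 4 * (u2 ^+ 3 * v2 - u2 * v2 ^+ 3).
Hypothesis VE : V = `|u1 * v2 - u2 * v1|.
Hypothesis V0 : 0 < V.
Hypothesis Fn0 : forall x y : int, (x, y) != (0, 0) -> F x y != 0.

Lemma quartic_lin (x y : int) : (F x y)%:~R =
  4 * U (x, y) * W (x, y) * (U (x, y) ^+ 2 - W (x, y) ^+ 2) :> R.
Proof.
rewrite /quartic /lin /= !intz !(intrD, intrM, rmorphXn) /= E0 E1 E2 E3 E4.
by ring.
Qed.

Lemma V_sqr : V ^+ 2 = (u1 * v2 - u2 * v1) ^+ 2.
Proof. by rewrite VE real_normK ?num_real. Qed.

(** The quadratic form A x^2 + B x y + C y^2 is 4 V (u^2 + v^2), whose square is a constant times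
    the Hessian of F. Its coefficients may be irrational, but all their pairwise products are
    integers. *)
Let A := 4 * V * (u1 ^+ 2 + v1 ^+ 2).
Let B := 8 * V * (u1 * u2 + v1 * v2).
Let C := 4 * V * (u2 ^+ 2 + v2 ^+ 2).

Lemma A_sqr : A ^+ 2 = (a1 ^+ 2 - 8 * a0 * b)%:~R.
Proof.
rewrite !(intrB, intrM, rmorphXn) /= E0 E1 E2 /A exprMn exprMn V_sqr; ring.
Qed.

Lemma A_mul_B : A * B = (2 * a1 * b - 4 * a0 * a3)%:~R.
Proof.
rewrite !(intrB, intrM, rmorphXn) /= E0 E1 E2 E3 /A /B.
transitivity (32 * V ^+ 2 * (u1 ^+ 2 + v1 ^+ 2) * (u1 * u2 + v1 * v2)); first by ring.
by rewrite V_sqr; ring.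
Qed.

Lemma A_mul_C : A * C = (4 * b ^+ 2 - a1 * a3)%:~R.
Proof.
rewrite !(intrB, intrM, rmorphXn) /= E1 E2 E3 /A /C.
transitivity (16 * V ^+ 2 * (u1 ^+ 2 + v1 ^+ 2) * (u2 ^+ 2 + v2 ^+ 2)); first by ring.
by rewrite V_sqr; ring.
Qed.

Lemma B_sqr : B ^+ 2 = (4 * (b ^+ 2 - 4 * a0 * a4))%:~R.
Proof.
rewrite !(intrB, intrM, rmorphXn) /= E0 E2 E4 /B !exprMn V_sqr; ring.
Qed.

Lemma B_mul_C : B * C = (2 * a3 * b - 4 * a1 * a4)%:~R.
Proof.
rewrite !(intrB, intrM, rmorphXn) /= E1 E2 E3 E4 /B /C.
transitivity (32 * V ^+ 2 * (u1 * u2 + v1 * v2) * (u2 ^+ 2 + v2 ^+ 2)); first by ring.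
by rewrite V_sqr; ring.
Qed.

Lemma C_sqr : C ^+ 2 = (a3 ^+ 2 - 8 * a4 * b)%:~R.
Proof.
rewrite !(intrB, intrM, rmorphXn) /= E2 E3 E4 /C exprMn exprMn V_sqr; ring.
Qed.

Lemma A_gt0 : 0 < A.
Proof.
have h : 0 <= u1 ^+ 2 + v1 ^+ 2 by rewrite addr_ge0 ?sqr_ge0.
rewrite /A mulr_gt0 ?mulr_gt0 // lt_neqAle h andbT eq_sym paddr_eq0 ?sqr_ge0 //.
rewrite !sqrf_eq0; apply/negP => /andP[/eqP u10 /eqP v10].
by move: V0; rewrite VE u10 v10 mul0r mulr0 subrr normr0 ltxx.
Qed.

Lemma norm_lin p : 4 * V * (U p ^+ 2 + W p ^+ 2) =
  A * p.1%:~R ^+ 2 + B * p.1%:~R * p.2%:~R + C * p.2%:~R ^+ 2.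
Proof. by rewrite /lin /A /B /C; ring. Qed.

Lemma norm_ge1 p : p != (0, 0) -> 1 <= U p ^+ 2 + W p ^+ 2.
Proof.
case: p => x y xy.
have F1 : 1 <= `|4 * U (x, y) * W (x, y) * (U (x, y) ^+ 2 - W (x, y) ^+ 2)|.
  by rewrite -quartic_lin; apply: norm_intr_ge1; [exact: intr_int | rewrite intr_eq0 Fn0].
move: (U _) (W _) F1 => u w F1.
have h : 1 <= (u ^+ 2 + w ^+ 2) ^+ 2.
  apply: (le_trans F1); rewrite ler_norml; apply/andP; split; rewrite -subr_ge0.
    rewrite (_ : _ - _ = (u ^+ 2 - w ^+ 2 + 2 * u * w) ^+ 2) ?sqr_ge0 //; by ring.
  rewrite (_ : _ - _ = (u ^+ 2 - w ^+ 2 - 2 * u * w) ^+ 2) ?sqr_ge0 //; by ring.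
by rewrite -(@expr_ge1 _ 2) // addr_ge0 ?sqr_ge0.
Qed.

(** The factor [mu] is d / A with d the gcd of A^2, A B, A C, up to sign, so that mu^2 = d^2 / A^2
    is an integer by [dvdz_gcd_sqr]. *)
Lemma quadratic_form_data : exists (mu : R) (a q c : int),
  [/\ 0 < mu, 1 <= mu ^+ 2, mu ^+ 2 \is a Num.int, 0 < a &
      [/\ A = mu * a%:~R, B = mu * q%:~R & C = mu * c%:~R]].
Proof.
pose n := a1 ^+ 2 - 8 * a0 * b; pose n1 := 2 * a1 * b - 4 * a0 * a3.
pose n2 := 4 * b ^+ 2 - a1 * a3.
have e11 : n1 ^+ 2 = n * (4 * (b ^+ 2 - 4 * a0 * a4)).
  by apply/eqP; rewrite -(eqr_int R) rmorphXn intrM /= -A_sqr -A_mul_B -B_sqr exprMn.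
have e12 : n1 * n2 = n * (2 * a3 * b - 4 * a1 * a4).
  by apply/eqP; rewrite -(eqr_int R) 2!intrM -A_sqr -A_mul_B -A_mul_C -B_mul_C; apply/eqP; ring.
have e22 : n2 ^+ 2 = n * (a3 ^+ 2 - 8 * a4 * b).
  by apply/eqP; rewrite -(eqr_int R) rmorphXn intrM /= -A_sqr -A_mul_C -C_sqr exprMn.
have [d [g [a [q [c [dg na n1q n2c]]]]]] := dvdz_gcd_sqr e11 e12 e22.
have A0 := A_gt0; have An0 : A != 0 by rewrite gt_eqF.
wlog d0 : d a q c dg na n1q n2c / 0 <= d => [W0|].
  case: (lerP 0 d) => dl; first exact: (W0 d a q c).
  apply: (W0 (- d) (- a) (- q) (- c)); rewrite ?sqrrN ?mulrNN //.
  by rewrite oppr_ge0 ltW.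
have n0 : 0 < n by rewrite -(ltr_int R) -A_sqr exprn_gt0.
have {}d0 : 0 < d.
  by rewrite lt_neqAle d0 andbT eq_sym; apply: contraTneq n0 => dz; rewrite na dz mulr0 ltxx.
have a_gt0 : 0 < a by move: n0; rewrite na pmulr_lgt0.
have dR0 : 0 < d%:~R :> R by rewrite ltr0z.
have AAn : A ^+ 2 = a%:~R * d%:~R by rewrite A_sqr -intrM -na.
have mu2 : (d%:~R / A) ^+ 2 = g%:~R.
  have dR : d%:~R ^+ 2 = A ^+ 2 * g%:~R by rewrite A_sqr -intrM -dg rmorphXn.
  by rewrite expr_div_n dR mulrAC mulfV ?mul1r // expf_neq0.
exists (d%:~R / A), a, q, c; split=> //.
- by rewrite divr_gt0.
- rewrite mu2 -[1]/(1%:~R) ler_int -gtz0_ge1 -(ltr_int R) -mu2.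
  by rewrite exprn_gt0 // divr_gt0.
- by rewrite mu2 intr_int.
split; apply: (mulfI An0).
- by rewrite -expr2 AAn; field.
- by rewrite A_mul_B -/n1 n1q intrM; field.
- by rewrite A_mul_C -/n2 n2c intrM; field.
Qed.

Lemma order_data : 3 / 4 <= V ^+ 2 /\ exists D : R,
  [/\ 0 < D, D <= 8 * V ^+ 2, D ^+ 2 \is a Num.int,
    forall p, 2 * D * (U p ^+ 4 - 6 * U p ^+ 2 * W p ^+ 2 + W p ^+ 4) \is a Num.int &
    forall p q, D * ((U p * U q + W p * W q) / V) \is a Num.int].
Proof.
have [mu [a [q [c [mu0 mu1 muZ a_gt0 [EA EB EC]]]]]] := quadratic_form_data.
have mun0 : mu != 0 by rewrite gt_eqF.
have Vn0 : V != 0 by rewrite gt_eqF.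
have V20 : 0 < V ^+ 2 by rewrite exprn_gt0.
have V40 : 0 < V ^+ 4 by rewrite exprn_gt0.
have DmuE : (4 * a * c - q ^+ 2)%:~R * mu ^+ 2 = 64 * V ^+ 4.
  transitivity (4 * A * C - B ^+ 2).
    by rewrite EA EB EC !(intrB, intrM, rmorphXn) /=; ring.
  transitivity (64 * V ^+ 2 * (u1 * v2 - u2 * v1) ^+ 2); first by rewrite /A /B /C; ring.
  by rewrite -V_sqr; ring.
have disc0 : 0 < 4 * a * c - q ^+ 2.
  by rewrite -(ltr_int R) -(pmulr_lgt0 _ (exprn_gt0 2 mu0)) DmuE mulr_gt0.
have norm_q p : 4 * V * (U p ^+ 2 + W p ^+ 2) =
    mu * (a * p.1 ^+ 2 + q * p.1 * p.2 + c * p.2 ^+ 2)%:~R.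
  by rewrite norm_lin EA EB EC !(intrD, intrM, rmorphXn) /=; ring.
pose D := 8 * V ^+ 2 / mu.
have D0 : 0 < D by rewrite divr_gt0 // mulr_gt0.
have D2E : D ^+ 2 = (4 * a * c - q ^+ 2)%:~R.
  apply: (mulIf (_ : mu ^+ 2 != 0)); first by rewrite expf_neq0.
  by rewrite DmuE /D; field.
have mu_ge1 : 1 <= mu by rewrite -(@expr_ge1 _ 2) // ltW.
split.
  (* At a short vector of the integral form Q, |Z| >= 1 and 4 V |Z|^2 = mu Q give 16 V^2 <= mu^2 Q^2
     <= 64 V^4 / 3. *)
  have [x [y [xy H]]] := hermite a_gt0 disc0.
  have := norm_ge1 xy; have := norm_q (x, y); rewrite /=.
  move: (U _ ^+ 2 + _) => N NE N1.
  move: H; rewrite -(ler_int R) intrM rmorphXn /=.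
  move: NE DmuE; set Q : R := (_ + _)%:~R; set De : R := (_ - _)%:~R => NE DmuE H.
  have h1 : (4 * V) ^+ 2 <= (mu * Q) ^+ 2.
    have V4_ge0 : 0 <= 4 * V by rewrite mulr_ge0 // ltW.
    have le1 : 4 * V <= 4 * V * N by rewrite ler_peMr.
    by rewrite -NE lerXn2r ?nnegrE // (le_trans V4_ge0).
  have h2 : 3 * (mu * Q) ^+ 2 <= 64 * V ^+ 4.
    rewrite -DmuE (_ : 3 * _ = (3 * Q ^+ 2) * mu ^+ 2); last by ring.
    by apply: ler_wpM2r; [exact: sqr_ge0 | exact: H].
  have h3 : 3 / 4 * V ^+ 2 <= V ^+ 2 * V ^+ 2 by rewrite -exprD; lra.
  by rewrite (ler_pM2r V20) in h3.
exists D; split=> //.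
- by rewrite /D ler_pdivrMr // ler_peMr // ltW // mulr_gt0.
- by rewrite D2E intr_int.
- case=> x y; apply: int_of_half.
    pose Fx := 4 * a0 * x ^+ 3 + 3 * a1 * x ^+ 2 * y + 6 * b * x * y ^+ 2 + a3 * y ^+ 3.
    pose Fy := a1 * x ^+ 3 + 6 * b * x ^+ 2 * y + 3 * a3 * x * y ^+ 2 + 4 * a4 * y ^+ 3.
    (* This is the Jacobian of F and the integral form. Differentiating F along rotations gives 4 X,
       so T is proportional to X. It only shows that 4 D X is an integer, whence [int_of_half]. *)
    pose T := Fx * (q * x + 2 * c * y) - Fy * (2 * a * x + q * y).
    have H : (u1 * v2 - u2 * v1) * V * (-32)
       * (U (x, y) ^+ 4 - 6 * U (x, y) ^+ 2 * W (x, y) ^+ 2 + W (x, y) ^+ 4) = mu * T%:~R.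
      transitivity (Fx%:~R * (B * x%:~R + 2 * C * y%:~R) - Fy%:~R * (2 * A * x%:~R + B * y%:~R)).
        rewrite /Fx /Fy !(intrD, intrM, rmorphXn) /= E0 E1 E2 E3 E4 /A /B /C /lin /=.
        by ring.
      by rewrite EA EB EC /T !(intrB, intrD, intrM) /=; ring.
    have dn0 : u1 * v2 - u2 * v1 != 0 by rewrite -normr_gt0 -VE.
    rewrite (_ : 2 * _ = - (V / (u1 * v2 - u2 * v1)) * T%:~R); last first.
      apply: (mulfI (_ : mu * (u1 * v2 - u2 * v1) != 0)); first exact: mulf_neq0.
      transitivity (- V * (mu * T%:~R)); last by field.
      by rewrite -H /D; field.
    rewrite rpredM ?intr_int // rpredN VE; case: (lerP 0 (u1 * v2 - u2 * v1)) => h.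
      by rewrite ger0_norm // mulfV // rpred1.
    by rewrite ltr0_norm // mulNr mulfV // rpredN rpred1.
  pose Q := a * x ^+ 2 + q * x * y + c * y ^+ 2.
  (* This is X^2 + F^2 = (u^2 + v^2)^4 multiplied by 4 D^2. *)
  rewrite (_ : _ ^+ 2 = mu ^+ 2 * (Q ^+ 4)%:~R - 4 * D ^+ 2 * ((F x y) ^+ 2)%:~R).
    apply: rpredB; first by apply: rpredM; [exact: muZ | exact: intr_int].
    apply: rpredM; last exact: intr_int.
    by apply: rpredM; [exact: rpred_nat | rewrite D2E intr_int].
  have NQ : U (x, y) ^+ 2 + W (x, y) ^+ 2 = mu * Q%:~R / (4 * V).
    by rewrite /Q -(norm_q (x, y)); field.
  have -> : mu ^+ 2 * (Q ^+ 4)%:~R = 4 * D ^+ 2 * (mu * Q%:~R / (4 * V)) ^+ 4.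
    by rewrite rmorphXn /= /D; field; rewrite mun0 Vn0.
  rewrite -NQ [((F x y) ^+ 2)%:~R]rmorphXn /= quartic_lin.
  by move: (U _) (W _) => u w; ring.
move=> p r.
pose T := 2 * a * p.1 * r.1 + q * (p.1 * r.2 + p.2 * r.1) + 2 * c * p.2 * r.2.
rewrite (_ : D * _ = T%:~R) ?intr_int //.
have H : 8 * V * (U p * U r + W p * W r) = mu * T%:~R.
  transitivity (2 * A * p.1%:~R * r.1%:~R + B * (p.1%:~R * r.2%:~R + p.2%:~R * r.1%:~R)
     + 2 * C * p.2%:~R * r.2%:~R); first by rewrite /lin /A /B /C; ring.
  by rewrite EA EB EC /T !(intrD, intrM) /=; ring.
transitivity (8 * V * (U p * U r + W p * W r) / mu).
  by rewrite /D; field; rewrite mun0.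
by rewrite H; field.
Qed.
End Covariants.

(** * From the form to its roots *)

(** A zero splits off a linear factor, ['X_1] or ['X_0 - r 'X_1]. Neither factor is a unit, because
    each vanishes at some point and units vanish nowhere. *)
Lemma quartic_no_zero (a0 a1 a2 a3 a4 : int) : irreducible_over_Q a0 a1 a2 a3 a4 ->
  forall x y : int, (x, y) != (0, 0) -> quartic a0 a1 a2 a3 a4 x y != 0.
Proof.
move=> [_ _ irr] x y xy; apply/negP => /eqP Fxy.
have evU (p : {mpoly rat[2]}) (v : 'I_2 -> rat) : p.@[v] = 0 -> p \isn't a GRing.unit.
  move=> pv; apply/negP => /(rmorph_unit (meval v)) /=.
  by rewrite pv unitr0.
have v0 (p q : {mpoly rat[2]}) : p \isn't a GRing.unit -> q \isn't a GRing.unit ->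
    quartic_form rat a0 a1 a2 a3 a4 = p * q -> False.
  by move=> pU qU /irr[]; apply/negP.
have [y0|y0] := eqVneq y 0.
  have a00 : a0 = 0.
    move: Fxy xy; rewrite y0 /quartic !expr0n /= !mulr0 !addr0 intz => /eqP.
    rewrite mulf_eq0 expf_eq0 /= => /orP[/eqP//|/eqP ->].
    by rewrite eqxx.
  apply: (v0 'X_1 (a1%:~R * 'X_0 ^+ 3 + a2%:~R * 'X_0 ^+ 2 * 'X_1 + a3%:~R * 'X_0 * 'X_1 ^+ 2
     + a4%:~R * 'X_1 ^+ 3)).
  - by apply: (evU _ (fun=> 0)); rewrite mevalXU.
  - apply: (evU _ (fun=> 0)).
    by rewrite !(mevalD, mevalM) /= !mevalXU; ring.
  by rewrite /quartic_form /quartic a00; ring.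
pose r : rat := x%:~R / y%:~R.
have yR : y%:~R != 0 :> rat by rewrite intr_eq0.
have Fr : a4%:~R + r * (a3%:~R + r * (a2%:~R + r * (a1%:~R + r * a0%:~R))) = 0.
  apply: (mulfI (expf_neq0 4 yR)); rewrite mulr0.
  transitivity ((quartic a0 a1 a2 a3 a4 x y)%:~R : rat); last by rewrite Fxy.
  by rewrite /quartic !intz !(intrD, intrM, rmorphXn) /= /r; field.
pose rM : {mpoly rat[2]} := r%:MP.
have FrM : a4%:~R + rM * (a3%:~R + rM * (a2%:~R + rM * (a1%:~R + rM * a0%:~R))) = 0.
  by rewrite -!(rmorph_int (mpolyC 2 (R := rat))) -!(rmorphM, rmorphD) /= Fr mpolyC0.
(* The coefficients of the quotient are those of Horner's scheme at r. *)
apply: (v0 ('X_0 - rM * 'X_1) (a0%:~R * 'X_0 ^+ 3 + (a1%:~R + rM * a0%:~R) * 'X_0 ^+ 2 * 'X_1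
   + (a2%:~R + rM * (a1%:~R + rM * a0%:~R)) * 'X_0 * 'X_1 ^+ 2
   + (a3%:~R + rM * (a2%:~R + rM * (a1%:~R + rM * a0%:~R))) * 'X_1 ^+ 3)).
- apply: (evU _ (fun i => if i == 0 then r else 1)).
  by rewrite mevalB mevalM !mevalXU mevalC /= mulr1 subrr.
- apply: (evU _ (fun=> 0)).
  by rewrite !(mevalD, mevalM) /= !mevalXU; ring.
rewrite /quartic_form /quartic.
transitivity (a0%:~R * 'X_0 ^+ 4 + a1%:~R * 'X_0 ^+ 3 * 'X_1 + a2%:~R * 'X_0 ^+ 2 * 'X_1 ^+ 2
  + a3%:~R * 'X_0 * 'X_1 ^+ 3 + a4%:~R * 'X_1 ^+ 4 -
  (a4%:~R + rM * (a3%:~R + rM * (a2%:~R + rM * (a1%:~R + rM * a0%:~R)))) * 'X_1 ^+ 4).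
  by rewrite FrM mul0r subr0.
by ring.
Qed.

Lemma split_coefs (R : realType) (a0 a1 a2 a3 a4 : int) : splits_over R a0 a1 a2 a3 a4 ->
  exists p q r s : R,
  [/\ a1%:~R = - (a0%:~R * (p + q + r + s)),
      a2%:~R = a0%:~R * (p * q + (p + q) * (r + s) + r * s),
      a3%:~R = - (a0%:~R * (p * q * (r + s) + (p + q) * (r * s))) &
      a4%:~R = a0%:~R * (p * q * (r * s))].
Proof.
move=> [al E].
pose p i := al (inord i); exists (p 0%N), (p 1%N), (p 2%N), (p 3%N).
have {}E : dehomog R a0 a1 a2 a3 a4 = a0%:~R *: (('X - (p 0%N)%:P) * ('X - (p 1%N)%:P)
    * ('X - (p 2%N)%:P) * ('X - (p 3%N)%:P)).
  rewrite E !big_ord_recl big_ord0 mulr1 !mulrA /p.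
  by congr (_ *: (('X - (al _)%:P) * ('X - (al _)%:P) * ('X - (al _)%:P) * ('X - (al _)%:P)));
     apply: val_inj; rewrite /= inordK.
have coefs (c4 c3 c2 c1 c0 : R) : let P := c4%:P * 'X^4 + c3%:P * 'X^3 + c2%:P * 'X^2 + c1%:P * 'X + c0%:P in
   [/\ P`_3 = c3, P`_2 = c2, P`_1 = c1 & P`_0 = c0].
  by split; rewrite !(coefD, coefCM, coefXn, coefX, coefC) /=; ring.
move: E; rewrite /dehomog /quartic !expr1n !mulr1.
have -> : a0%:~R * 'X^4 + a1%:~R * 'X^3 + a2%:~R * 'X^2 + a3%:~R * 'X + a4%:~R
  = (a0%:~R)%:P * 'X^4 + (a1%:~R)%:P * 'X^3 + (a2%:~R)%:P * 'X^2 + (a3%:~R)%:P * 'X + (a4%:~R)%:P :> {poly R}.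
  by rewrite !rmorph_int.
move: (a0%:~R : R) (p 0%N) (p 1%N) (p 2%N) (p 3%N) => b p0 p1 p2 p3.
have -> : b *: (('X - p0%:P) * ('X - p1%:P) * ('X - p2%:P) * ('X - p3%:P)) =
   b%:P * 'X^4 + (- (b * (p0 + p1 + p2 + p3)))%:P * 'X^3
   + (b * (p0 * p1 + (p0 + p1) * (p2 + p3) + p2 * p3))%:P * 'X^2
   + (- (b * (p0 * p1 * (p2 + p3) + (p0 + p1) * (p2 * p3))))%:P * 'X
   + (b * (p0 * p1 * (p2 * p3)))%:P.
  by rewrite -mul_polyC !(polyCN, polyCM, polyCD); ring.
set P1 := (X in X = _); set P2 := (X in _ = X) => EP.
have [h3 h2 h1 h0] := coefs b a1%:~R a2%:~R a3%:~R a4%:~R.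
have [k3 k2 k1 k0] := coefs b (- (b * (p0 + p1 + p2 + p3)))
  (b * (p0 * p1 + (p0 + p1) * (p2 + p3) + p2 * p3))
  (- (b * (p0 * p1 * (p2 + p3) + (p0 + p1) * (p2 * p3)))) (b * (p0 * p1 * (p2 * p3))).
by split; [rewrite -h3 -k3|rewrite -h2 -k2|rewrite -h1 -k1|rewrite -h0 -k0]; rewrite -/P1 EP.
Qed.

(** * The normal form and the four lines *)

Lemma in_sectorE (R : realType) (u v : R) : in_sector u v = (2 * `|u * v| <= u ^+ 2 - v ^+ 2).
Proof.
rewrite /in_sector real_normK ?num_real // normrM -subr_ge0 -[RHS]subr_ge0.
by congr (0 <= _); ring.
Qed.

(** With Z = u + i w, the four cases say that Re Z^2, - Re Z^2, Im Z^2 or - Im Z^2 is the largest of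
    the four. *)
Lemma sectors_cover (R : realType) (c u w : R) : c ^+ 2 = 1 / 2 ->
  [\/ in_sector u w, in_sector w (- u), in_sector (c * (u + w)) (c * (u - w)) |
      in_sector (c * (u - w)) (- (c * (u + w)))].
Proof.
move=> c2; rewrite !in_sectorE !mulrN !normrN !sqrrN [w * u]mulrC.
have -> : c * (u - w) * (c * (u + w)) = c * (u + w) * (c * (u - w)) by ring.
have -> : c * (u + w) * (c * (u - w)) = (u ^+ 2 - w ^+ 2) / 2.
  by transitivity (c ^+ 2 * (u ^+ 2 - w ^+ 2)); [ring | rewrite c2; field].
have -> : (c * (u + w)) ^+ 2 - (c * (u - w)) ^+ 2 = 2 * (u * w).
  by transitivity (c ^+ 2 * (4 * (u * w))); [ring | rewrite c2; field].
have -> : (c * (u - w)) ^+ 2 - (c * (u + w)) ^+ 2 = - (2 * (u * w)).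
  by transitivity (- (c ^+ 2 * (4 * (u * w)))); [ring | rewrite c2; field].
have nE : `|(u ^+ 2 - w ^+ 2) / 2| = `|u ^+ 2 - w ^+ 2| / 2.
  by rewrite normrM normfV (ger0_norm (_ : 0 <= 2)).
rewrite nE; case: (lerP (2 * `|u * w|) (u ^+ 2 - w ^+ 2)) => h1; first by constructor 1.
case: (lerP (2 * `|u * w|) (w ^+ 2 - u ^+ 2)) => h2; first by constructor 2.
have h3 : `|u ^+ 2 - w ^+ 2| <= 2 * `|u * w| by rewrite ler_norml; apply/andP; split; lra.
case: (lerP 0 (u * w)) => h4.
  by constructor 3; rewrite (ger0_norm h4) in h3; lra.
by constructor 4; rewrite (ltr0_norm h4) in h3; lra.
Qed.

Section Cover.
Variable R : realType.
Variables (a0 a1 b a3 a4 : int).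
Local Notation F x y := (quartic a0 a1 (3 * b) a3 a4 x y).
Hypothesis Fn0 : forall x y : int, (x, y) != (0, 0) -> F x y != 0.

(* [F = 4 u v (u^2 - v^2)], coefficientwise. *)
Definition normal_form (u1 u2 v1 v2 : R) :=
  [/\ a0%:~R = 4 * (u1 ^+ 3 * v1 - u1 * v1 ^+ 3),
      a1%:~R = 4 * (u1 ^+ 3 * v2 + 3 * u1 ^+ 2 * u2 * v1
                              - (v1 ^+ 3 * u2 + 3 * v1 ^+ 2 * v2 * u1)),
      b%:~R = 4 * (u1 ^+ 2 * u2 * v2 + u1 * u2 ^+ 2 * v1
                              - v1 ^+ 2 * v2 * u2 - v1 * v2 ^+ 2 * u1),
      a3%:~R = 4 * (3 * u1 * u2 ^+ 2 * v2 + u2 ^+ 3 * v1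
                              - 3 * v1 * v2 ^+ 2 * u2 - v2 ^+ 3 * u1) &
      a4%:~R = 4 * (u2 ^+ 3 * v2 - u2 * v2 ^+ 3)].

Lemma normal_form_sector u1 u2 v1 v2 : normal_form u1 u2 v1 v2 ->
  u1 * v2 - u2 * v1 != 0 ->
  exists s : seq (int * int), (size s <= 3)%N /\
    forall x y : int, `|F x y| = 1 ->
      in_sector (lin u1 u2 (x, y)) (lin v1 v2 (x, y)) ->
      (x, y) \in s \/ (- x, - y) \in s.
Proof.
move=> [E0 E1 E2 E3 E4] d0.
have V0 : 0 < `|u1 * v2 - u2 * v1| by rewrite normr_gt0.
have [V34 [D [D0 Dle DZ XZ dotZ]]] := order_data E0 E1 E2 E3 E4 erefl V0 Fn0.
have [s [ss cov]] := sector_cover erefl V0 V34 D0 Dle DZ XZ dotZ.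
exists s; split=> // x y Fxy sec; apply: cov => //=.
by rewrite -(quartic_lin E0 E1 E2 E3 E4) -intr_norm Fxy.
Qed.

Lemma normal_form_rot90 u1 u2 v1 v2 : normal_form u1 u2 v1 v2 ->
  normal_form v1 v2 (- u1) (- u2).
Proof. by move=> [E0 E1 E2 E3 E4]; split; rewrite ?(E0, E1, E2, E3, E4); ring. Qed.

(** The substitution replaces u v by (u^2 - v^2) / 2 and u^2 - v^2 by 2 u v, so their product is
    unchanged. *)
Lemma normal_form_rot45 c u1 u2 v1 v2 : c ^+ 2 = 1 / 2 -> normal_form u1 u2 v1 v2 ->
  normal_form (c * (u1 + v1)) (c * (u2 + v2)) (c * (u1 - v1)) (c * (u2 - v2)).
Proof.
move=> c2; have c4 : 4 * c ^+ 4 = 1.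
  by rewrite (_ : c ^+ 4 = c ^+ 2 * c ^+ 2); [rewrite c2; field | ring].
have key z : z = 4 * c ^+ 4 * z by rewrite c4 mul1r.
by move=> [E0 E1 E2 E3 E4]; split; rewrite ?(E0, E1, E2, E3, E4) [LHS]key; ring.
Qed.

Lemma normal_form_cover u1 u2 v1 v2 : normal_form u1 u2 v1 v2 ->
  u1 * v2 - u2 * v1 != 0 ->
  exists s : seq (int * int), (size s <= 12)%N /\
    forall x y : int, `|F x y| = 1 -> (x, y) \in s \/ (- x, - y) \in s.
Proof.
move=> nf d0; pose c : R := Num.sqrt (1 / 2).
have c2 : c ^+ 2 = 1 / 2 by rewrite sqr_sqrtr //; lra.
have nf' := normal_form_rot45 c2 nf.
have d0' : c * (u1 + v1) * (c * (u2 - v2)) - c * (u2 + v2) * (c * (u1 - v1)) != 0.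
  rewrite (_ : _ - _ = - (2 * c ^+ 2) * (u1 * v2 - u2 * v1)); last by ring.
  by rewrite c2 mulf_neq0 // oppr_eq0 mulf_neq0 ?pnatr_eq0 // mul1r invr_eq0 pnatr_eq0.
have rotd (x1 x2 y1 y2 : R) : x1 * y2 - x2 * y1 != 0 -> y1 * - x2 - y2 * - x1 != 0.
  by rewrite (_ : y1 * _ - _ = x1 * y2 - x2 * y1) //; ring.
have [s1 [z1 c1]] := normal_form_sector nf d0.
have [s2 [z2 cov2]] := normal_form_sector (normal_form_rot90 nf) (rotd _ _ _ _ d0).
have [s3 [z3 c3]] := normal_form_sector nf' d0'.
have [s4 [z4 c4]] := normal_form_sector (normal_form_rot90 nf') (rotd _ _ _ _ d0').
exists (s1 ++ s2 ++ s3 ++ s4); split; first by rewrite !size_cat; lia.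
move=> x y Fxy; rewrite !mem_cat.
have linN (e f : R) p : lin (- e) (- f) p = - lin e f p by rewrite /lin; ring.
have linD (e f e' f' : R) p : lin (c * (e + e')) (c * (f + f')) p = c * (lin e f p + lin e' f' p).
  by rewrite /lin; ring.
have linB (e f e' f' : R) p : lin (c * (e - e')) (c * (f - f')) p = c * (lin e f p - lin e' f' p).
  by rewrite /lin; ring.
have := sectors_cover (lin u1 u2 (x, y)) (lin v1 v2 (x, y)) c2.
rewrite -linD -linB -!linN => -[sec|sec|sec|sec].
- by have [->|->] := c1 x y Fxy sec; [left | right]; rewrite ?orbT.
- by have [->|->] := cov2 x y Fxy sec; [left | right]; rewrite ?orbT.
- by have [->|->] := c3 x y Fxy sec; [left | right]; rewrite ?orbT.
- by have [->|->] := c4 x y Fxy sec; [left | right]; rewrite ?orbT.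
Qed.

(** * From harmonic roots to the normal form *)

(** The product z = m n must be the fourth root of [al * be]; then m^2 = al / z and n^2 = be / z. *)
Lemma cubes_solve (al be : R) : 0 < al -> 0 < be ->
  exists m n, [/\ 0 < m, 0 < n, m ^+ 3 * n = al & m * n ^+ 3 = be].
Proof.
move=> al0 be0; pose z := Num.sqrt (Num.sqrt (al * be)).
have ab0 : 0 < al * be by rewrite mulr_gt0.
have z0 : 0 < z by rewrite !sqrtr_gt0.
have zn0 : z != 0 by rewrite gt_eqF.
have z4 : z ^+ 4 = al * be.
  by rewrite (exprM z 2 2) !sqr_sqrtr // ?sqrtr_ge0 // ltW.
have m2 : Num.sqrt (al / z) ^+ 2 = al / z by rewrite sqr_sqrtr // ltW // divr_gt0.
have n2 : Num.sqrt (be / z) ^+ 2 = be / z by rewrite sqr_sqrtr // ltW // divr_gt0.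
have mn : Num.sqrt (al / z) * Num.sqrt (be / z) = z.
  rewrite -sqrtrM; last by rewrite ltW // divr_gt0.
  rewrite (_ : al / z * (be / z) = z ^+ 2); first by rewrite sqrtr_sqr gtr0_norm.
  by transitivity (al * be / z ^+ 2); [field | rewrite -z4; field].
exists (Num.sqrt (al / z)), (Num.sqrt (be / z)).
split; rewrite ?sqrtr_gt0 ?divr_gt0 //.
  rewrite exprSr -mulrA mn m2; by field.
rewrite exprS mulrA mn n2; by field.
Qed.

(** A triple root is rational, hence gives an integral zero of F. The Hessian is a constant times P
    (x - t y)^4, so its two leading coefficients determine t when P is nonzero; otherwise t is a
    quadruple root, equal to - a1 / (4 a0). *)
Lemma no_triple_root (t w : R) :
  a1%:~R = - (a0%:~R * (3 * t + w)) -> 3 * b%:~R = a0%:~R * (3 * t ^+ 2 + 3 * t * w) ->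
  a3%:~R = - (a0%:~R * (t ^+ 3 + 3 * t ^+ 2 * w)) -> a4%:~R = a0%:~R * (t ^+ 3 * w) -> False.
Proof.
move=> e1 e2 e3 e4.
have FE (x y : int) : (F x y)%:~R = a0%:~R * (x%:~R - t * y%:~R) ^+ 3 * (x%:~R - w * y%:~R) :> R.
  by rewrite /quartic !intz !(intrD, intrM, rmorphXn) /= e1 e2 e3 e4; ring.
have a00 : a0 != 0.
  have := @Fn0 1 0 isT; apply: contraNneq => a00.
  by rewrite -(eqr_int R) FE a00 !mul0r.
pose P := a1 ^+ 2 - 8 * a0 * b.
have PE : P%:~R = a0%:~R ^+ 2 * (t - w) ^+ 2 :> R.
  rewrite /P !(intrB, intrM, rmorphXn) /= e1.
  transitivity ((a0%:~R * (3 * t + w)) ^+ 2 - 8 / 3 * a0%:~R * (3 * b%:~R)); first by field.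
  by rewrite e2; field.
have [P0|P0] := eqVneq P 0.
  have tw : t = w.
    move: PE; rewrite P0 => /esym/eqP; rewrite mulf_eq0 !sqrf_eq0 intr_eq0 (negPf a00) /=.
    by rewrite subr_eq0 => /eqP.
  have nz : (- a1, 4 * a0) != (0, 0) by rewrite xpair_eqE negb_and mulf_eq0 negb_or a00 orbT.
  have := Fn0 nz; rewrite -(eqr_int R) FE.
  rewrite (_ : (- a1)%:~R - t * (4 * a0)%:~R = 0); last by rewrite intrM mulrNz e1 tw; ring.
  by rewrite expr0n /= mulr0 mul0r eqxx.
have nz : (- (a1 * b - 2 * a0 * a3), P) != (0, 0) by rewrite xpair_eqE negb_and P0 orbT.
have := Fn0 nz; rewrite -(eqr_int R) FE.
rewrite (_ : (- _)%:~R - t * P%:~R = 0); first by rewrite expr0n /= mulr0 mul0r eqxx.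
rewrite PE mulrNz !(intrB, intrM) /= e3.
transitivity (- (a1%:~R * (3 * b%:~R) / 3 + 2 * a0%:~R * (a0%:~R * (t ^+ 3 + 3 * t ^+ 2 * w)))
   - t * (a0%:~R ^+ 2 * (t - w) ^+ 2)); first by field.
by rewrite e1 e2; field.
Qed.

Lemma harmonic_cover (p q r s : R) :
  a1%:~R = - (a0%:~R * (p + q + r + s)) ->
  3 * b%:~R = a0%:~R * (p * q + (p + q) * (r + s) + r * s) ->
  a3%:~R = - (a0%:~R * (p * q * (r + s) + (p + q) * (r * s))) ->
  a4%:~R = a0%:~R * (p * q * (r * s)) ->
  (p - r) * (s - q) = (p - s) * (q - r) ->
  exists s : seq (int * int), (size s <= 12)%N /\
    forall x y : int, `|F x y| = 1 -> (x, y) \in s \/ (- x, - y) \in s.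
Proof.
move=> e1 e2 e3 e4 h.
pose B := (p - r) * (s - q).
have hA : (p - q) * (r - s) = - 2 * B.
  transitivity (- (p - r) * (s - q) - (p - s) * (q - r)); first by ring.
  by rewrite -h /B; ring.
have h' : 2 * (p * q) + 2 * (r * s) = (p + q) * (r + s).
  apply/eqP; rewrite -subr_eq0.
  rewrite (_ : _ - _ = (p - s) * (q - r) - (p - r) * (s - q)); last by ring.
  by rewrite h subrr.
(* If B = 0, the products (p - r)(s - q) and (p - q)(r - s) both vanish and three of the roots
   coincide. *)
have [B0|B0] := eqVneq B 0.
  exfalso; move: hA; rewrite B0 mulr0 => /eqP; rewrite mulf_eq0 !subr_eq0.
  move: (B0); rewrite /B => /eqP; rewrite mulf_eq0 !subr_eq0 => h1 h2.
  case/orP: h2 => /eqP h2; case/orP: h1 => /eqP h1.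
  - by apply: (no_triple_root (t := p) (w := s)); rewrite ?(e1, e2, e3, e4) -?h2 -?h1; ring.
  - by apply: (no_triple_root (t := p) (w := r)); rewrite ?(e1, e2, e3, e4) h1 -?h2; ring.
  - by apply: (no_triple_root (t := p) (w := q)); rewrite ?(e1, e2, e3, e4) -h2 -h1; ring.
  - by apply: (no_triple_root (t := q) (w := p)); rewrite ?(e1, e2, e3, e4) h2 h1; ring.
have pq : p - q != 0.
  by apply: contraNneq B0 => E; move: hA; rewrite E mul0r => /esym/eqP;
     rewrite mulf_eq0 oppr_eq0 pnatr_eq0.
have a00 : a0 != 0.
  have := @Fn0 1 0 isT; apply: contraNneq => a00.
  by rewrite /quartic a00 !expr0n /= mul0r !mulr0 !addr0.
have a0R : a0%:~R != 0 :> R by rewrite intr_eq0.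
(* Harmonicity gives a0 (x - r y)(x - s y) = k1 (x - p y)^2 - k2 (x - q y)^2, where k1 and k2 are
   found at x = q and x = p with y = 1. [R1], [R2], [R3] are its coefficients, and u = m (x - p y),
   v = n (x - q y) is the normal form. *)
pose k1 := a0%:~R * ((r - q) * (s - q)) / (p - q) ^+ 2.
pose k2 := - (a0%:~R * ((r - p) * (s - p)) / (p - q) ^+ 2).
have R1 : k1 - k2 = a0%:~R.
  transitivity (a0%:~R * ((p - q) ^+ 2 + (2 * (p * q) + 2 * (r * s) - (p + q) * (r + s))) / (p - q) ^+ 2).
    by rewrite /k1 /k2; field.
  by rewrite h' subrr addr0; field.
have R2 : 2 * p * k1 - 2 * q * k2 = a0%:~R * (r + s).
  transitivity (a0%:~R * ((r + s) * (p - q) ^+ 2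
     + (p + q) * (2 * (p * q) + 2 * (r * s) - (p + q) * (r + s))) / (p - q) ^+ 2).
    by rewrite /k1 /k2; field.
  by rewrite h' subrr mulr0 addr0; field.
have R3 : p ^+ 2 * k1 - q ^+ 2 * k2 = a0%:~R * (r * s).
  transitivity (a0%:~R * ((r * s) * (p - q) ^+ 2
     + (p * q) * (2 * (p * q) + 2 * (r * s) - (p + q) * (r + s))) / (p - q) ^+ 2).
    by rewrite /k1 /k2; field.
  by rewrite h' subrr mulr0 addr0; field.
(* By harmonicity the product is a square, so k1 and k2 have the same sign, as real m and n
   require. *)
have kk : 0 < k1 * k2.
  have -> : k1 * k2 = (a0%:~R * B / (p - q) ^+ 2) ^+ 2.
    transitivity (a0%:~R ^+ 2 * (((p - r) * (s - q)) * ((p - s) * (q - r))) / (p - q) ^+ 4).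
      by rewrite /k1 /k2; field.
    by rewrite -h -/B; field.
  by rewrite exprn_even_gt0 //= mulf_neq0 ?invr_eq0 ?expf_neq0 // mulf_neq0.
suff [m [n [mn0 K1 K2]]] : exists m n : R, [/\ m * n != 0, 4 * (m ^+ 3 * n) = k1 & 4 * (m * n ^+ 3) = k2].
  apply: (@normal_form_cover m (- (m * p)) n (- (n * q))); last first.
    rewrite (_ : m * _ - _ = m * n * (p - q)); last by ring.
    exact: mulf_neq0.
  split.
  - by rewrite -R1 -K1 -K2; ring.
  - rewrite e1 (_ : a0%:~R * _ = a0%:~R * (p + q) + a0%:~R * (r + s)); last by ring.
    by rewrite -R2 -R1 -K1 -K2; ring.
  - apply: (@mulfI _ 3); first by rewrite pnatr_eq0.
    rewrite e2 (_ : a0%:~R * _ = a0%:~R * (p * q) + (p + q) * (a0%:~R * (r + s)) + a0%:~R * (r * s)); last by ring.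
    by rewrite -R2 -R3 -R1 -K1 -K2; ring.
  - rewrite e3 (_ : a0%:~R * _ = p * q * (a0%:~R * (r + s)) + (p + q) * (a0%:~R * (r * s))); last by ring.
    by rewrite -R2 -R3 -K1 -K2; ring.
  - rewrite e4 (_ : a0%:~R * _ = p * q * (a0%:~R * (r * s))); last by ring.
    by rewrite -R3 -K1 -K2; ring.
have [k10|k10] := ltrP 0 k1.
  have k20 : 0 < k2 by rewrite -(pmulr_rgt0 _ k10).
  have [m [n [m0 n0 M N]]] := @cubes_solve (k1 / 4) (k2 / 4) (divr_gt0 k10 (ltr0Sn _ _)) (divr_gt0 k20 (ltr0Sn _ _)).
  exists m, n; rewrite M N gt_eqF ?mulr_gt0 //; split=> //; by field.
have {}k10 : k1 < 0.
  by rewrite lt_neqAle k10 andbT; apply: contraTneq kk => ->; rewrite mul0r ltxx.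
have k20 : k2 < 0 by rewrite -(nmulr_rgt0 _ k10).
have [||m [n [m0 n0 M N]]] := @cubes_solve (- k1 / 4) (- k2 / 4).
- by rewrite divr_gt0 // oppr_gt0.
- by rewrite divr_gt0 // oppr_gt0.
exists m, (- n); rewrite mulrN oppr_eq0 gt_eqF ?mulr_gt0 //; split=> //.
  by rewrite mulrN M; field.
by rewrite (_ : (- n) ^+ 3 = - n ^+ 3); [rewrite mulrN N; field | ring].
Qed.
End Cover.

Theorem theorem1p1 (R : realType) (a0 a1 a2 a3 a4 : int)
    (F_irr : irreducible_over_Q a0 a1 a2 a3 a4)
    (F_disc : 0 < disc R a0 a1 a2 a3 a4)
    (F_split : splits_over R a0 a1 a2 a3 a4)
    (F_J0 : invJ a0 a1 a2 a3 a4 = 0) :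
  exists s : seq (int * int),
    (size s <= 12)%N /\
    forall x y : int, `|quartic a0 a1 a2 a3 a4 x y| = 1 ->
      (x, y) \in s \/ (- x, - y) \in s.
Proof.
have Fn0 := quartic_no_zero F_irr.
have a00 : a0%:~R != 0 :> R.
  rewrite intr_eq0; have := @Fn0 1 0 isT; apply: contraNneq => a00.
  by rewrite /quartic a00 !expr0n /= mul0r !mulr0 !addr0.
(* Every term of J except 2 a2^3 is visibly divisible by 3; hence the middle coefficient has the
   form 3 b. *)
have /dvdzP[b a2E] : (3 %| a2)%Z.
  have : (3 %| 2 * a2 ^+ 3)%Z.
    apply/dvdzP; exists (3 * a1 * a2 * a3 - 9 * a1 ^+ 2 * a4 + 24 * a0 * a2 * a4
      - 9 * a0 * a3 ^+ 2).
    by apply/eqP; rewrite -subr_eq0 -F_J0 /invJ; apply/eqP; ring.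
  by rewrite Gauss_dvdzr // !dvdzE abszX /= Euclid_dvdX // andbT.
have [p [q [r [s [e1 e2 e3 e4]]]]] := split_coefs F_split.
(* In terms of the roots, J is up to sign a0^3 times the product of the differences of these three
   products; it vanishes exactly when some pairing of the roots is harmonic. *)
have J0 : (p - q) * (r - s) = (p - r) * (s - q) \/
    (p - r) * (s - q) = (p - s) * (q - r) \/ (p - s) * (q - r) = (p - q) * (r - s).
  have : a0%:~R ^+ 3 * (((p - q) * (r - s) - (p - r) * (s - q)) *
    ((p - r) * (s - q) - (p - s) * (q - r)) * ((p - s) * (q - r) - (p - q) * (r - s))) = 0 :> R.
    transitivity (- (invJ a0 a1 a2 a3 a4)%:~R : R); last by rewrite F_J0 oppr0.
    rewrite /invJ !(intrD, intrB, intrM, rmorphXn, mulrNz) /= e1 e2 e3 e4.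
    by ring.
  move/eqP; rewrite mulf_eq0 expf_eq0 (negPf a00) /= !mulf_eq0 !subr_eq0 -orbA.
  by case/or3P => /eqP; [left | right; left | right; right].
move: e2 Fn0; rewrite a2E mulrC intrM => e2 Fn0.
(* The cases differ by a cyclic relabelling of q, r, s. *)
case: J0 => [h|[h|h]].
- apply: (harmonic_cover Fn0 (p := p) (q := s) (r := q) (s := r)) => //.
  + by rewrite e1; ring.
  + by rewrite e2; ring.
  + by rewrite e3; ring.
  + by rewrite e4; ring.
- exact: (harmonic_cover Fn0 e1 e2 e3 e4 h).
- apply: (harmonic_cover Fn0 (p := p) (q := r) (r := s) (s := q)) => //.
  + by rewrite e1; ring.
  + by rewrite e2; ring.
  + by rewrite e3; ring.
  + by rewrite e4; ring.
Qed.
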